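(* Let $f\in L^2(0,1)$ and let $g(x)=\int_0^x \frac{f(y)}{\sqrt{x-y}}\,dy$ ($0\leqslant x\leqslant1$) be its Abel transform. Let $\varepsilon>0$ and let $g^{(\varepsilon)}$ be a noisy data function on $(0,1)$ such that $$\left\|g-g^{(\varepsilon)}\right\|_{L^2_\mu(0,1)}\leqslant\varepsilon .$$ Let $f_N=\sum_{n=0}^N c_n\overline{P}_n$ and $f_N^{(\varepsilon)}=\sum_{n=0}^N c_n^{(\varepsilon)}\overline{P}_n$ be the truncated Legendre expansions built from $g$ and $g^{(\varepsilon)}$ respectively, as defined in the context. Then, for every integer $N\geqslant 0$, $$\left\|f_N-f_N^{(\varepsilon)}\right\|_{L^2(0,1)}\leqslant\frac{N+1}{\sqrt{\pi}}\,\varepsilon .$$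
   Context: $\overline{P}_n(x)=\sqrt{2n+1}\,P_n(2x-1)$, with $P_n$ the ordinary Legendre polynomials; $\{\overline{P}_n\}_{n\geqslant0}$ is an orthonormal basis of $L^2(0,1)$. The measure $\mu$ on $(0,1)$ is $d\mu(x)=\frac{dx}{\sqrt{x(1-x)}}$, and $L^2_\mu(0,1)$ is the space of measurable $u:(0,1)\to\mathbb{R}$ with $\|u\|_{L^2_\mu(0,1)}=\left(\int_0^1|u(x)|^2\,d\mu(x)\right)^{1/2}<\infty$. The coefficients $c_n=\int_0^1 f(x)\overline{P}_n(x)\,dx$ are the Legendre coefficients of $f$; equivalently (for $n\geqslant 0$) $c_n=(-1)^n\sqrt{2n+1}\int_{-\pi}^{\pi}\eta(t)e^{int}\,dt$ with $\eta(t)=\frac{\operatorname{sgn}(t)}{2\pi i}e^{it/2}g(\sin^2\frac t2)$, $t\in[-\pi,\pi)$. The noisy coefficients are $c_n^{(\varepsilon)}=(-1)^n\sqrt{2n+1}\int_{-\pi}^{\pi}\eta^{(\varepsilon)}(t)e^{int}\,dt$ with $\eta^{(\varepsilon)}(t)=\frac{\operatorname{sgn}(t)}{2\pi i}e^{it/2}g^{(\varepsilon)}(\sin^2\frac t2)$, $t\in[-\pi,\pi)$. *)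

(* Defs.v *)
(* Library: MathComp and MathComp-Analysis; the complex numbers R[i] come from
   mathcomp-real-closed. *)
From HB Require Import structures.
From mathcomp Require Import all_boot all_order all_algebra.
From mathcomp Require Import all_classical all_reals all_analysis measurable_realfun.
From mathcomp Require Import complex.

Set Implicit Arguments.
Unset Strict Implicit.
Unset Printing Implicit Defensive.

Import Order.TTheory GRing.Theory Num.Theory.
Import numFieldNormedType.Exports.

Local Open Scope classical_set_scope.
Local Open Scope ring_scope.
Local Open Scope complex_scope.

(* Values outside ]0, 1[ are irrelevant: functions on (0, 1) are represented by
   functions R -> R, cut off by the restriction u \_ `]0, 1[. *)
Definition L2norm01 (R : realType)
    (m : {measure set (measurableTypeR R) -> \bar R}) (u : R -> R) : \bar R :=
  'N[m]_2%:E[EFin \o (u \_ `]0, 1[)].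

Definition complex_L2norm01 (R : realType)
    (m : {measure set (measurableTypeR R) -> \bar R}) (u : R -> R[i]) : \bar R :=
  L2norm01 m (fun x => ComplexField.Normc.normc (u x)).

Definition L2on01 (R : realType)
    (m : {measure set (measurableTypeR R) -> \bar R}) (u : R -> R) : Prop :=
  measurable_fun (`]0, 1[ : set R) u /\ (L2norm01 m u < +oo)%E.

Definition arcsine_density (R : realType) (x : R) : R :=
  (Num.sqrt (x * (1 - x)))^-1.

Definition arcsine_measure (R : realType) (A : set (measurableTypeR R)) :
    \bar R :=
  \int[lebesgue_measure]_(x in A `&` `]0, 1[) (arcsine_density x)%:E.

Section arcsine_measure_instance.
Context {R : realType}.
Local Open Scope ereal_scope.

Let dens_ge0 (x : R) : 0 <= (arcsine_density x)%:E.
Proof. by rewrite lee_fin /arcsine_density invr_ge0 sqrtr_ge0. Qed.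

Lemma measurable_arcsine_density :
  measurable_fun (`]0%R, 1%R[ : set (measurableTypeR R)) (@arcsine_density R).
Proof.
apply: open_continuous_measurable_fun.
  exact: interval_open.
move=> x; rewrite inE/= in_itv/= => /andP[x0 x1].
apply: (@cvgV _ _ _ (nbhs_filter x) (fun y : R => Num.sqrt (y * (1 - y))%R)).
  by rewrite gt_eqF// sqrtr_gt0 mulr_gt0// subr_gt0.
apply: (@continuous_comp _ _ _ (fun y : R => (y * (1 - y))%R) Num.sqrt);
  last exact: sqrt_continuous.
apply: cvgM; first exact: cvg_id.
by apply: cvgB; [exact: cvg_cst | exact: cvg_id].
Qed.

Let arcsine_measure0 : arcsine_measure (set0 : set (measurableTypeR R)) = 0.
Proof. by rewrite /arcsine_measure set0I integral_set0. Qed.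

Let arcsine_measure_ge0 (A : set (measurableTypeR R)) : 0 <= arcsine_measure A.
Proof. by apply: integral_ge0 => x _; exact: dens_ge0. Qed.

Let arcsine_measure_sigma_additive : semi_sigma_additive (@arcsine_measure R).
Proof.
move=> /= A mA tA mUA.
rewrite /arcsine_measure setI_bigcupl ge0_integral_bigcup//=.
- apply: is_cvg_ereal_nneg_natsum_cond => n _ _.
  by apply: integral_ge0 => x _; exact: dens_ge0.
- by move=> k; apply: measurableI => //; exact: measurable_itv.
- apply/measurable_EFinP; apply: measurable_funS measurable_arcsine_density => //.
  by move=> x [k _ []].
- exact: trivIset_setIr.
Qed.

HB.instance Definition _ := isMeasure.Build _ _ _ (@arcsine_measure R)
  arcsine_measure0 arcsine_measure_ge0 arcsine_measure_sigma_additive.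

End arcsine_measure_instance.

Definition abel (R : realType) (f : R -> R) (x : R) : R :=
  \int[lebesgue_measure]_(y in `]0, x[) (f y / Num.sqrt (x - y)).

Definition legendre (R : realType) (n : nat) : {poly R} :=
  (2 ^+ n * n`!%:R)^-1 *: (('X^2 - 1) ^+ n)^`(n).

Definition shifted_legendre (R : realType) (n : nat) (x : R) : R :=
  Num.sqrt (2 * n%:R + 1) * (legendre R n).[2 * x - 1].

Definition legendre_coef (R : realType) (f : R -> R) (n : nat) : R :=
  \int[lebesgue_measure]_(x in `]0, 1[) (f x * shifted_legendre n x).

Definition expi (R : realType) (t : R) : R[i] := cos t +i* sin t.

Definition complex_integral (R : realType) (D : set R) (F : R -> R[i]) : R[i] :=
  (\int[lebesgue_measure]_(t in D) complex.Re (F t)) +i*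
  (\int[lebesgue_measure]_(t in D) complex.Im (F t)).

Definition eta (R : realType) (h : R -> R) (t : R) : R[i] :=
  (Num.sg t)%:C / ((2 * pi)%:C * 'i) * expi (t / 2) * (h (sin (t / 2) ^+ 2))%:C.

(* The Legendre coefficient recovered from the Abel data h; a priori complex. *)
Definition data_coef (R : realType) (h : R -> R) (n : nat) : R[i] :=
  (-1) ^+ n * (Num.sqrt (2 * n%:R + 1))%:C *
  complex_integral `[- pi, pi[ (fun t => eta h t * expi (n%:R * t)).

Definition legendre_sum (R : realType) (c : nat -> R[i]) (N : nat) (x : R) :
    R[i] :=
  \sum_(n < N.+1) c n * (shifted_legendre n x)%:C.

(* Main.v *)
From HB Require Import structures.
Require Import Defs.
From mathcomp Require Import all_boot all_order all_algebra.
From mathcomp Require Import all_classical all_reals all_analysis measurable_realfun.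
From mathcomp Require Import complex.
From mathcomp Require Import ring lra zify.

(** The error of the truncated expansions is a finite Legendre sum
    [\sum_n d_n P_n], so by orthonormality of the shifted Legendre polynomials
    (lemma [legendre_parseval]) its squared norm is [\sum_n d_n^2], and it
    suffices to show [d_n^2 <= (2 n + 1) eps^2 / pi]: the odd numbers up to
    [2 N + 1] add up to [(N + 1)^2].

    The substance is that the Legendre coefficients of [f] are the data
    coefficients of its Abel transform [g] (lemma [legendre_coef_abel]).  The
    integrand that defines a data coefficient has an even real part and an odd
    imaginary part, so a data coefficient is the real number
    [(-1)^n sqrt(2 n + 1) / pi * \int_0^pi g(sin^2(t/2)) sin((n + 1/2) t) dt]
    (lemma [data_coef_real]).  After the substitution [x = sin^2(t/2)], writing
    [g] as an integral over [y < x] and exchanging the two integrals, the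
    kernel that multiplies [f y] is, up to sign, an integral over [`]y, 1[] of
    a polynomial [airfoil n] in [1 - x] against [dx / sqrt((x - y)(1 - x))].
    The second substitution [x = y + (1 - y) sin^2(t/2)] turns the powers of
    [1 - x] into Wallis integrals, and the comparison of coefficients with
    those of the Legendre polynomial at the endpoint 1 identifies the kernel
    with [pi P_n(2 y - 1)].  This is the Mehler-Dirichlet formula (lemma
    [mehler_dirichlet]).

    The factor [sin((n + 1/2) t)] vanishes at 0 like [sin(t/2)], which cancels
    the singularity of [dx / sqrt(x (1 - x))] at 0.  This is why Fubini applies
    as soon as [f] is integrable.

    By linearity [d_n] is the same expression with [g] replaced by the noise
    [h], the difference of [g] and the noisy data.  The
    substitution [x = sin^2(t/2)] maps [dt] on [`]0, pi[] to [dx / sqrt(x(1-x))],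
    so [h(sin^2(t/2))] has norm at most [eps] in [L^2(0, pi)], hence
    norm at most [eps sqrt(pi)] in [L^1(0, pi)], and
    [`|d_n| <= sqrt(2 n + 1) / pi * (eps * sqrt pi)]. *)

Set Implicit Arguments.
Unset Strict Implicit.
Unset Printing Implicit Defensive.

Import Order.TTheory GRing.Theory Num.Theory.
Import numFieldNormedType.Exports.

Local Open Scope classical_set_scope.
Local Open Scope ring_scope.
Local Open Scope complex_scope.

(** * Integrals of derivatives *)

Section ftc_oo.
Variable R : realType.
Implicit Types (f F : R -> R) (a b : R).
Local Notation leb := (@lebesgue_measure R).

Lemma continuous_integrable_oo f a b : continuous f ->
  leb.-integrable `]a, b[ (EFin \o f).
Proof.
move=> cf; have : leb.-integrable `[a, b] (EFin \o f).
  apply: continuous_compact_integrable; first exact: segment_compact.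
  exact/continuous_subspaceT.
apply: integrableS => //.
by apply: subset_itv; rewrite bnd_simp.
Qed.

Lemma integral_derivative_oo F f a b : a < b -> continuous f ->
  (forall x : R, is_derive x 1 F (f x)) ->
  (\int[leb]_(x in `]a, b[) (f x)%:E = (F b - F a)%:E)%E.
Proof.
move=> ab cf dF.
have mf (i : interval R) : measurable_fun [set` i] (EFin \o f).
  apply/measurable_EFinP; apply: measurable_funTS.
  exact: continuous_measurable_fun.
have cF (x : R) : {for x, continuous F}.
  have [dFx _] := dF x.
  by apply: differentiable_continuous; exact/derivable1_diffP.
rewrite integral_itv_obnd_cbnd; last exact: mf.
rewrite integral_itv_bndo_bndc; last exact: mf.
rewrite (@continuous_FTC2 _ _ F)//=.
- exact/continuous_subspaceT.
- split=> [x _||]; first by have [] := dF x.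
  + exact/cvg_at_right_filter/cF.
  + exact/cvg_at_left_filter/cF.
- by move=> x _; rewrite derive1E; have [_ ->] := dF x.
Qed.

Lemma Rintegral_derivative_oo F f a b : a < b -> continuous f ->
  (forall x : R, is_derive x 1 F (f x)) ->
  \int[leb]_(x in `]a, b[) f x = F b - F a.
Proof. by move=> ab cf dF; rewrite /Rintegral (integral_derivative_oo ab cf dF). Qed.

End ftc_oo.

(** * Chebyshev polynomials of the third kind *)

Section airfoil.
Variable R : realType.

(** Coefficients of [V_n (1 - 2 u)], where [V_n] is the Chebyshev polynomial of
    the third kind: [V_n (cos s) = cos((n + 1/2) s) / cos(s / 2)]. *)
Definition airfoil (n : nat) (u : R) : R :=
  \sum_(k < n.+1) (- 4) ^+ k * 'C(n + k, k.*2)%:R * u ^+ k.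

Lemma airfoil_widen n m (u : R) : (n <= m)%N ->
  airfoil n u = \sum_(k < m.+1) (- 4) ^+ k * 'C(n + k, k.*2)%:R * u ^+ k.
Proof.
move=> nm; rewrite /airfoil.
rewrite (big_ord_widen m.+1 (fun k => (- 4) ^+ k * 'C(n + k, k.*2)%:R * u ^+ k))//.
rewrite [RHS](bigID (fun k : 'I_m.+1 => (k < n.+1)%N))/=.
rewrite [X in _ + X]big1 ?addr0// => k; rewrite -leqNgt => nk.
by rewrite bin_small ?mulr0 ?mul0r// -addnn ltn_add2r.
Qed.

(** The three-term recurrence [V_(n+2) + V_n = 2 x V_(n+1)] at [x = 1 - 2 u];
    coefficientwise it is Pascal's rule applied three times. *)
Lemma airfoil_rec n (u : R) :
  airfoil n.+2 u = 2 * (1 - 2 * u) * airfoil n.+1 u - airfoil n u.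
Proof.
apply/eqP; rewrite eq_sym subr_eq eq_sym; apply/eqP.
rewrite (@airfoil_widen n n.+2 u (leqW (leqnSn n))) {1}/airfoil -big_split/=.
transitivity (2 * airfoil n.+1 u - 4 * u * airfoil n.+1 u); last by ring.
rewrite {1}(@airfoil_widen n.+1 n.+2 u (leqnSn _)) mulr_sumr.
rewrite [in RHS]/airfoil mulr_sumr -sumrN.
rewrite big_ord_recl [X in _ = X + _]big_ord_recl/= -[in RHS]addrA -big_split/=.
congr (_ + _); first by rewrite !bin0; ring.
apply: eq_bigr => i _; rewrite /bump/= !add1n.
rewrite !addnS !addSn !doubleS.
set m := (n + i)%N; set j := (i.*2)%N.
rewrite (_ : 'C(m.+3, j.+2)%:R = 2 * 'C(m.+2, j.+2)%:R + 'C(m.+1, j)%:R - 'C(m.+1, j.+2)%:R :> R).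
  by rewrite !exprS; ring.
rewrite (binS m.+2 j.+1) (binS m.+1 j) (binS m.+1 j.+1) !natrD; ring.
Qed.

(** Both sides satisfy the recurrence coming from
    [sin(s + t) + sin(s - t) = 2 cos t sin s], with [cos t = 2 cos^2(t/2) - 1]. *)
Lemma sin_half_airfoil n (t : R) :
  sin ((n%:R + 2^-1) * t) =
  (-1) ^+ n * sin (t / 2) * airfoil n (cos (t / 2) ^+ 2).
Proof.
have a0 u : airfoil 0 u = 1 by rewrite /airfoil big_ord1 /= bin0 !expr0; ring.
have a1 u : airfoil 1 u = 1 - 4 * u.
  by rewrite /airfoil big_ord_recl big_ord1 /= binn bin0 !expr0 !expr1; ring.
have ct : cos t = 2 * cos (t / 2) ^+ 2 - 1.
  rewrite [in LHS](_ : t = t / 2 + t / 2); last by field.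
  by rewrite cosD -!expr2 sin2cos2; ring.
have step m : sin ((m.+2%:R + 2^-1) * t) =
    2 * cos t * sin ((m.+1%:R + 2^-1) * t) - sin ((m%:R + 2^-1) * t).
  rewrite (_ : (m.+2%:R + 2^-1) * t = (m.+1%:R + 2^-1) * t + t); last first.
    by rewrite -[m.+2]addn1 natrD; ring.
  rewrite (_ : (m%:R + 2^-1) * t = (m.+1%:R + 2^-1) * t - t); last first.
    by rewrite -[m.+1]addn1 natrD; ring.
  by rewrite sinB sinD; ring.
suff : sin ((n%:R + 2^-1) * t) =
  (-1) ^+ n * sin (t / 2) * airfoil n (cos (t / 2) ^+ 2) /\
  sin ((n.+1%:R + 2^-1) * t) =
  (-1) ^+ n.+1 * sin (t / 2) * airfoil n.+1 (cos (t / 2) ^+ 2) by case.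
elim: n => [|n [IH0 IH1]]; split => //.
- by rewrite a0 add0r (_ : 2^-1 * t = t / 2); [ring|field].
- rewrite a1 (_ : (1 + 2^-1) * t = t / 2 + t); last by field.
  rewrite sinD ct [in sin t](_ : t = t / 2 + t / 2); last by field.
  rewrite sinD; ring.
- by rewrite step IH0 IH1 airfoil_rec ct !exprS; ring.
Qed.

End airfoil.

(** * Legendre polynomials: expansion at 1 and orthonormality *)

Section legendre_algebra.
Variable R : realType.
Implicit Types p q : {poly R}.

Lemma derivn_XsubC_exp (c : R) m n :
  (('X - c%:P) ^+ m)^`(n) = ('X - c%:P) ^+ (m - n) *+ (m ^_ n).
Proof.
elim: n => [|n IH]; first by rewrite subn0 ffactn0 mulr1n.
rewrite derivnS IH derivMn deriv_exp derivXsubC mul1r -mulrnA subnS.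
by rewrite ffactnSr mulnC.
Qed.

(** In the Rodrigues formula, expand [(X + 1)^n = (2 + (X - 1))^n] in powers of
    [X - 1]: the derivatives of the resulting powers are explicit. *)
Lemma legendre_expansion n (y : R) : (legendre R n).[2 * y - 1] =
  \sum_(k < n.+1) (- 1) ^+ k * ('C(n, k) * 'C(n + k, k))%:R * (1 - y) ^+ k.
Proof.
have -> : legendre R n = \sum_(k < n.+1)
   (('C(n, k) * 'C(n + k, k))%:R / 2 ^+ k) *: ('X - 1%:P) ^+ k.
  rewrite /legendre (_ : 'X^2 - 1 = ('X - 1%:P) * (2%:P + ('X - 1%:P)) :> {poly R}); last first.
    by rewrite expr2 polyCMn; ring.
  rewrite exprMn_comm; last exact: mulrC.
  rewrite [(2%:P + _) ^+ n]exprDn mulr_sumr raddf_sum/= scaler_sumr; apply: eq_bigr => k _.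
  rewrite [X in X^`(n)]mulrnAr [X in (X *+ _)^`(n)]mulrCA -exprD derivnMn.
  rewrite -polyC_exp mul_polyC derivnZ derivn_XsubC_exp addKn.
  rewrite -[_ *+ (n + k) ^_ n]scaler_nat -[_ *+ 'C(n, k)]scaler_nat !scalerA; congr (_ *: _).
  rewrite -[(n + k)%N ^_ n]bin_ffact.
  rewrite -[X in 'C(X, n)]addnC -(@bin_sub (k + n) n) ?leq_addl// addnK addnC.
  have n0 : n`!%:R != 0 :> R by rewrite pnatr_eq0 -lt0n fact_gt0.
  have kn : (k <= n)%N by rewrite -ltnS.
  rewrite -{1}(subnK kn) exprD !natrM; field.
  by rewrite n0 !expf_neq0.
rewrite horner_sum; apply: eq_bigr => k _.
rewrite hornerZ horner_exp hornerXsubC.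
rewrite (_ : 2 * y - 1 - 1 = - 2 * (1 - y)); last by ring.
rewrite exprMn (_ : - 2 = -1 * 2) ?exprMn; last by ring.
by field; rewrite expf_neq0.
Qed.

(** Linear functional on polynomials: integrals of Legendre polynomials are
    computed below from its value on derivatives only. *)
Definition shifted_mean p : R :=
  \int[lebesgue_measure]_(x in `]0%R, 1%R[) p.[2 * x - 1].

Lemma continuous_shifted_horner p : continuous (fun x : R => p.[2 * x - 1]).
Proof.
move=> x; apply: (@continuous_comp _ _ _ (fun x : R => 2 * x - 1) (horner p)).
  by apply: cvgB; [apply: cvgM; [exact: cvg_cst|exact: cvg_id]|exact: cvg_cst].
exact: continuous_horner.
Qed.

Lemma integrable_shifted_horner p :
  lebesgue_measure.-integrable `]0%R, 1%R[ (EFin \o (fun x : R => p.[2 * x - 1])).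
Proof. exact/continuous_integrable_oo/continuous_shifted_horner. Qed.

Lemma shifted_meanD p q :
  shifted_mean (p + q) = shifted_mean p + shifted_mean q.
Proof.
rewrite /shifted_mean -RintegralD//; try exact: integrable_shifted_horner.
by apply: eq_Rintegral => x _; rewrite hornerD.
Qed.

Lemma shifted_meanZ (a : R) p : shifted_mean (a *: p) = a * shifted_mean p.
Proof.
rewrite /shifted_mean -RintegralZl//; last exact: integrable_shifted_horner.
by apply: eq_Rintegral => x _; rewrite hornerZ.
Qed.

Lemma shifted_mean_deriv p : shifted_mean p^`() = (p.[1] - p.[-1]) / 2.
Proof.
have dp (x : R) :
    is_derive x 1 (fun x : R => 2^-1 * p.[2 * x - 1]) p^`().[2 * x - 1].
  by apply: trigger_derive; rewrite /GRing.scale/=; field.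
rewrite /shifted_mean (Rintegral_derivative_oo ltr01 _ dp)//; last first.
  exact: continuous_shifted_horner.
by rewrite mulr1 mulr0 sub0r -mulrBr mulrC; congr ((_.[_] - _) / _); ring.
Qed.

Lemma shifted_mean_parts p q : q.[1] = 0 -> q.[-1] = 0 ->
  shifted_mean (p * q^`()) = - shifted_mean (p^`() * q).
Proof.
move=> q1 qN1; apply/eqP; rewrite -addr_eq0 -shifted_meanD addrC -derivM.
by rewrite shifted_mean_deriv !hornerM q1 qN1 !mulr0 subrr mul0r.
Qed.

Lemma derivn_exp_factor q n j :
  exists r, (q ^+ n)^`(j) = q ^+ (n - j) * r.
Proof.
elim: j => [|j [r Er]]; first by exists 1; rewrite mulr1 subn0.
have [nj|jn] := leqP n j.
  have -> : (n - j.+1 = 0)%N by apply/eqP; rewrite subn_eq0 ltnW.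
  by eexists; rewrite expr0 mul1r.
rewrite derivnS Er derivM deriv_exp -subnS.
exists (q^`() *+ (n - j) * r + q * r^`()).
by rewrite -[X in _ ^+ X * _^`()](subnSK jn) exprSr; ring.
Qed.

Let w : {poly R} := 'X^2 - 1.

Let w1 : w.[1] = 0. Proof. by rewrite !hornerE expr1n subrr. Qed.
Let wN1 : w.[-1] = 0. Proof. by rewrite !hornerE sqrrN expr1n subrr. Qed.

Lemma derivn_rodrigues_root x n j : w.[x] = 0 -> (j < n)%N ->
  (w ^+ n)^`(j).[x] = 0.
Proof.
move=> wx jn; have [r ->] := derivn_exp_factor w n j.
by rewrite hornerM horner_exp wx expr0n subn_eq0 leqNgt jn mul0r.
Qed.

(** Integration by parts [n] times: [X^2 - 1] vanishes at both endpoints, so no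
    boundary term survives before all [n] derivatives have been moved. *)
Lemma shifted_mean_rodrigues p n :
  shifted_mean (p * (w ^+ n)^`(n)) = (-1) ^+ n * shifted_mean (p^`(n) * w ^+ n).
Proof.
have H j : (j <= n)%N -> shifted_mean (p * (w ^+ n)^`(n)) =
    (-1) ^+ j * shifted_mean (p^`(j) * (w ^+ n)^`(n - j)).
  elim: j => [_|j IH jn]; first by rewrite subn0 expr0 mul1r.
  rewrite (IH (ltnW jn)) -(subnSK jn) [in LHS]derivnS.
  have njn : (n - j.+1 < n)%N by rewrite ltn_subrL (leq_trans _ jn).
  rewrite shifted_mean_parts ?derivn_rodrigues_root// derivnS.
  by rewrite exprS mulN1r mulrN mulNr.
by rewrite (H n)// subnn.
Qed.

Lemma shifted_mean_const (c : R) : shifted_mean c%:P = c.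
Proof.
have -> : c%:P = (c *: 'X)^`() by rewrite derivZ derivX -mul_polyC mulr1.
by rewrite shifted_mean_deriv !hornerE; field.
Qed.

(** Wallis-type recursion, obtained by integrating the derivative of
    [X (X^2 - 1)^(n+1)]. *)
Lemma shifted_mean_rodrigues_weight n :
  shifted_mean (w ^+ n) * (n.*2.+1)`!%:R = (- 4) ^+ n * n`!%:R ^+ 2.
Proof.
elim: n => [|n IH].
  by rewrite !expr0 -polyC1 shifted_mean_const double0 factS fact0; ring.
have rec : (n.*2.+3)%:R * shifted_mean (w ^+ n.+1) =
    - (n.+1.*2)%:R * shifted_mean (w ^+ n).
  have /eqP : shifted_mean ('X * w ^+ n.+1)^`() = 0.
    by rewrite shifted_mean_deriv !hornerM !horner_exp w1 wN1 !expr0n !mulr0 subrr mul0r.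
  have -> : ('X * w ^+ n.+1)^`() =
      (n.*2.+3)%:R *: w ^+ n.+1 + (n.+1.*2)%:R *: w ^+ n.
    rewrite derivM derivX mul1r deriv_exp /w derivB derivXn -polyC1 derivC subr0/=.
    rewrite -/w !scaler_nat exprS -!muln2; set v := w ^+ n; rewrite /w.
    rewrite -[_ *+ n.+1]mulr_natl -['X^1 *+ 2]mulr_natl -[_ *+ (n * 2).+3]mulr_natl.
    by rewrite -[_ *+ (n.+1 * 2)]mulr_natl expr1; ring.
  by rewrite shifted_meanD !shifted_meanZ mulNr addr_eq0 => /eqP.
move: rec IH; set a := shifted_mean _; set b := shifted_mean _ => rec IH.
rewrite doubleS factS natrM factS natrM [in RHS]factS [in RHS]natrM.
rewrite mulrA mulrA -[a * _]mulrC rec doubleS exprS.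
transitivity (- (n.*2.+2)%:R * (n.*2.+2)%:R * (b * (n.*2.+1)`!%:R)); first by ring.
rewrite IH -doubleS -muln2; ring.
Qed.

Let size_w n : size (w ^+ n) = n.*2.+1.
Proof.
have sw : size w = 3%N by rewrite /w size_polyDl size_polyXn// size_polyN size_poly1.
have := size_exp w n; rewrite sw /= mul2n => <-; rewrite prednK// lt0n size_poly_eq0.
by rewrite expf_neq0// -size_poly_eq0 sw.
Qed.

Let w_monic n : w ^+ n \is monic.
Proof. by apply: monic_exp; rewrite /w -polyC1 monicXnsubC. Qed.

Lemma derivn_monic q d : q \is monic -> size q = d.+1 -> q^`(d) = (d`!%:R)%:P.
Proof.
move=> qm sq; apply/polyP => i; rewrite coef_derivn coefC.
case: i => [|i]; last by rewrite nth_default ?mul0rn// sq addnS ltnS leq_addr.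
by rewrite addn0 ffactnn -[d]/(d.+1.-1) -{1}sq -lead_coefE (monicP qm).
Qed.

Lemma size_legendre n : (size (legendre R n) <= n.+1)%N.
Proof.
rewrite /legendre -/w (leq_trans (size_scale_leq _ _))//.
by rewrite cauchyreals.size_derivn size_w -addnn -addSn addnK.
Qed.

(** For [m < n] the [n]-th derivative of the Legendre polynomial of degree [m]
    vanishes; for [m = n] it is a constant, and only the mean of
    [(X^2 - 1)^n] remains. *)
Lemma shifted_mean_legendreM m n :
  shifted_mean (legendre R m * legendre R n) = (m == n)%:R / (2 * n%:R + 1).
Proof.
wlog mn : m n / (m <= n)%N => [H|].
  have [mn|/ltnW nm] := leqP m n; first exact: H.
  rewrite mulrC H// eq_sym; have [->//|_] := eqVneq; by rewrite !mul0r.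
rewrite {2}/legendre -/w -scalerAr shifted_meanZ shifted_mean_rodrigues.
have [->|nm] := eqVneq m n; last first.
  rewrite derivn_poly0 ?mul0r; last first.
    by rewrite (leq_trans (size_legendre m))// ltn_neqAle nm.
  by rewrite -polyC0 shifted_mean_const !mulr0.
rewrite {1}/legendre -/w derivnZ /derivn -iterD -/(derivn _ _) addnn.
rewrite (derivn_monic (w_monic n) (size_w n)) -scalerAl shifted_meanZ.
rewrite mul_polyC shifted_meanZ.
have := shifted_mean_rodrigues_weight n; set b := shifted_mean _.
rewrite factS natrM.
set F := ((n.*2)`!%:R : R); set G := (n`!%:R : R) => E.
have F0 : F != 0 by rewrite pnatr_eq0 -lt0n fact_gt0.
have G0 : G != 0 by rewrite pnatr_eq0 -lt0n fact_gt0.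
have n1 : (n.*2.+1)%:R = 2 * n%:R + 1 :> R by rewrite -addn1 natrD -mul2n natrM.
have n0 : 2 * n%:R + 1 != 0 :> R by rewrite -n1 pnatr_eq0.
have -> : b = (- 4) ^+ n * G ^+ 2 / (2 * n%:R + 1) / F.
  by rewrite -E n1; field; rewrite n0 F0.
have -> : (- 4) ^+ n = (- 1) ^+ n * 2 ^+ n * 2 ^+ n :> R.
  by rewrite -!exprMn; congr (_ ^+ _); ring.
have s1 : (-1) ^+ n * (-1) ^+ n = 1 :> R by rewrite -exprMn mulrNN mulr1 expr1n.
transitivity (((-1) ^+ n * (-1) ^+ n) / (2 * n%:R + 1) : R).
  field.
  by rewrite F0 G0 n0 !expf_neq0.
by rewrite s1.
Qed.

(** The factor [sqrt(2 n + 1)] is what makes the shifted polynomials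
    orthonormal. *)
Lemma legendre_parseval N (d : nat -> R) :
  (\int[lebesgue_measure]_(x in `]0%R, 1%R[)
    ((\sum_(n < N.+1) d n * shifted_legendre n x) ^+ 2)%:E =
   (\sum_(n < N.+1) d n ^+ 2)%:E)%E.
Proof.
pose c n := d n * Num.sqrt (2 * n%:R + 1).
pose p := \sum_(n < N.+1) c n *: legendre R n.
have pE x : \sum_(n < N.+1) d n * shifted_legendre n x = p.[2 * x - 1].
  by rewrite horner_sum; apply: eq_bigr => n _; rewrite hornerZ /shifted_legendre mulrA.
under eq_integral do rewrite pE -horner_exp.
rewrite -(@fineK _ (integral _ _ _)); last first.
  apply: integrable_fin_num => //; exact: integrable_shifted_horner.
congr EFin; rewrite -[LHS]/(shifted_mean (p ^+ 2)).
have smsum (F : 'I_N.+1 -> {poly R}) :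
    shifted_mean (\sum_(n < N.+1) F n) = \sum_(n < N.+1) shifted_mean (F n).
  apply: (big_morph shifted_mean shifted_meanD).
  by rewrite -polyC0 shifted_mean_const.
rewrite expr2 {1}/p mulr_suml smsum; apply: eq_bigr => m _.
rewrite -scalerAl shifted_meanZ /p mulr_sumr smsum (bigD1 m)//= big1 => [|n nm].
  rewrite -scalerAr shifted_meanZ shifted_mean_legendreM eqxx addr0 /c mulr1n.
  have m0 : 0 < 2 * m%:R + 1 :> R by rewrite ltr_wpDl// mulr_ge0.
  have m1 := gt_eqF m0.
  transitivity (d m ^+ 2 * Num.sqrt (2 * m%:R + 1) ^+ 2 / (2 * m%:R + 1)).
    by field; rewrite m1.
  by rewrite sqr_sqrtr ?ltW// mulfK ?m1.
rewrite -scalerAr shifted_meanZ shifted_mean_legendreM.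
rewrite (_ : (_ == _) = false) ?mul0r ?mulr0//.
by apply/negbTE; rewrite eq_sym; exact: nm.
Qed.

End legendre_algebra.

(** * Wallis integrals *)

Section wallis.
Variable R : realType.

Definition cos_moment k : R :=
  \int[lebesgue_measure]_(t in `]0%R, pi[) cos (t / 2) ^+ k.*2.

Lemma continuous_cos_half_exp k : continuous (fun t : R => cos (t / 2) ^+ k).
Proof.
move=> t; apply: (@continuous_comp _ _ _ (fun t : R => cos (t / 2)) (fun x => x ^+ k)).
  apply: (@continuous_comp _ _ _ (fun t : R => t / 2) cos); last exact: continuous_cos.
  by apply: cvgM; [exact: cvg_id|exact: cvg_cst].
exact: exprn_continuous.
Qed.

Lemma is_derive_half (t : R) : is_derive t 1 (fun t : R => t / 2) 2^-1.
Proof. by apply: trigger_derive; rewrite /GRing.scale/=; ring. Qed.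

Lemma is_derive_sin_half (t : R) :
  is_derive t 1 (fun t : R => sin (t / 2)) (cos (t / 2) / 2).
Proof.
have dh := is_derive_half t.
exact: (@is_derive1_comp _ sin (fun t : R => t / 2)).
Qed.

Lemma is_derive_cos_half (t : R) :
  is_derive t 1 (fun t : R => cos (t / 2)) (- (sin (t / 2) / 2)).
Proof.
have dh := is_derive_half t; rewrite -mulNr.
exact: (@is_derive1_comp _ cos (fun t : R => t / 2)).
Qed.

Lemma is_derive_cos_half_exp k (t : R) :
  is_derive t 1 (fun t : R => cos (t / 2) ^+ k)
    (k%:R * cos (t / 2) ^+ k.-1 * - (sin (t / 2) / 2)).
Proof.
have dc := is_derive_cos_half t.
rewrite -(exprfctE (fun t : R => cos (t / 2))).
exact: is_deriveX.
Qed.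

(** Integrate the derivative of [2 sin(t/2) cos(t/2)^(2k+1)], which vanishes at
    both ends of the interval. *)
Lemma cos_moment_rec k :
  k.+1.*2%:R * cos_moment k.+1 = k.*2.+1%:R * cos_moment k.
Proof.
pose g (t : R) := k.+1.*2%:R * cos (t / 2) ^+ k.+1.*2 - k.*2.+1%:R * cos (t / 2) ^+ k.*2.
have ig m : lebesgue_measure.-integrable `]0%R, pi[
    (EFin \o (fun t : R => cos (t / 2) ^+ m)).
  exact/continuous_integrable_oo/continuous_cos_half_exp.
have dg (t : R) : is_derive t 1 (fun t => 2 * sin (t / 2) * cos (t / 2) ^+ k.*2.+1) (g t).
  have := is_derive_cos_half_exp k.*2.+1 t; have := is_derive_sin_half t.
  move=> ds dc.
  apply: trigger_derive; rewrite /GRing.scale/= /g.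
  have s2 : sin (t / 2) * sin (t / 2) = 1 - cos (t / 2) ^+ 2.
    by rewrite -expr2 sin2cos2.
  rewrite doubleS !exprS; set C := cos (t / 2) ^+ k.*2.
  transitivity (- k.*2.+1%:R * C * (sin (t / 2) * sin (t / 2)) + cos (t / 2) ^+ 2 * C).
    by field.
  by rewrite s2; ring.
have cm (a : R) m : continuous (fun t : R => a * cos (t / 2) ^+ m).
  by move=> t; apply: cvgM; [exact: cvg_cst|exact: continuous_cos_half_exp].
have cg : continuous g by move=> t; apply: cvgB; exact: cm.
have := Rintegral_derivative_oo (pi_gt0 R) cg dg.
rewrite cos_pihalf expr0n mulr0 mul0r sin0 mulr0 mul0r subr0.
rewrite RintegralB//; [|exact/continuous_integrable_oo/cm..].
by rewrite !RintegralZl// => /eqP; rewrite subr_eq0 => /eqP.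
Qed.

Lemma cos_moment_fact k :
  4 ^+ k * k`!%:R ^+ 2 * cos_moment k = pi * (k.*2)`!%:R.
Proof.
elim: k => [|k IH].
  rewrite /cos_moment; under eq_Rintegral do rewrite expr0.
  rewrite Rintegral_cst//= lebesgue_measure_itv/= lte_fin pi_gt0/=.
  by rewrite double0 fact0 !expr0; ring.
transitivity (4 * k.+1%:R / 2 * (4 ^+ k * k`!%:R ^+ 2 * (k.+1.*2%:R * cos_moment k.+1))).
  rewrite factS natrM -mul2n natrM exprS; field => //.
rewrite cos_moment_rec.
transitivity (4 * k.+1%:R / 2 * k.*2.+1%:R * (4 ^+ k * k`!%:R ^+ 2 * cos_moment k)).
  by ring.
rewrite IH doubleS factS natrM factS natrM.
set F := (k.*2)`!%:R; rewrite -doubleS -[k.+1.*2]mul2n natrM; field => //.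
Qed.

(** After multiplication by [(n - k)!] both sides are [(n + k)!]. *)
Lemma central_multinomial n k : (k <= n)%N ->
  ('C(n + k, k.*2) * (k.*2)`! = 'C(n, k) * 'C(n + k, k) * k`! ^ 2)%N.
Proof.
move=> kn.
have e1 : ('C(n + k, k.*2) * ((k.*2)`! * (n - k)`!) = (n + k)`!)%N.
  have h : (k.*2 <= n + k)%N by rewrite -addnn leq_add2r.
  by rewrite -(bin_fact h) -addnn subnDr.
have e2 : ('C(n, k) * (k`! * (n - k)`!) = n`!)%N by exact: bin_fact.
have e3 : ('C(n + k, k) * (k`! * n`!) = (n + k)`!)%N.
  by rewrite -(bin_fact (leq_addl n k)) addnK.
apply/eqP; rewrite -(eqn_pmul2r (fact_gt0 (n - k))); apply/eqP.
rewrite -mulnA e1 -e3 -e2; nia.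
Qed.

(** The form in which the moments turn the coefficients of the Chebyshev
    polynomial into those of the Legendre polynomial. *)
Lemma cos_moment_binomial n k : (k <= n)%N ->
  4 ^+ k * 'C(n + k, k.*2)%:R * cos_moment k =
  pi * ('C(n, k) * 'C(n + k, k))%:R.
Proof.
move=> kn; have k0 : k`!%:R != 0 :> R by rewrite pnatr_eq0 -lt0n fact_gt0.
apply: (@mulfI _ (k`!%:R ^+ 2)); first by rewrite expf_neq0.
transitivity ('C(n + k, k.*2)%:R * (4 ^+ k * k`!%:R ^+ 2 * cos_moment k)); first by ring.
rewrite cos_moment_fact mulrCA -natrM central_multinomial// natrM natrX; ring.
Qed.

End wallis.

(** * Densities and uniqueness of finite Borel measures *)

Section density.
Local Open Scope ereal_scope.
Context d (T : measurableType d) (R : realType).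
Variable mu : {measure set T -> \bar R}.
Variable g : T -> R.
Hypotheses (mg : measurable_fun [set: T] g) (g0 : forall x, (0 <= g x)%R).

Lemma exists_density_measure :
  exists m : {measure set T -> \bar R},
    forall A, m A = \int[mu]_(x in A) (g x)%:E.
Proof.
pose m A := \int[mu]_(x in A) (g x)%:E.
have m0 : m set0 = 0 by rewrite /m integral_set0.
have m_ge0 A : 0 <= m A by apply: integral_ge0 => x _; rewrite lee_fin.
have mS : semi_sigma_additive m.
  apply: semi_sigma_additive_nng_induced; first exact/measurable_EFinP.
  by move=> x; rewrite lee_fin.
pose b := isMeasure.Build _ _ _ m m0 m_ge0 mS.
pose M : {measure set T -> \bar R} := HB.pack m b.
by exists M.
Qed.

Import HBNNSimple.

(** True for indicators by hypothesis, hence for nonnegative simple functions,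
    hence for all nonnegative measurable functions by monotone convergence. *)
Lemma ge0_integral_density (m : {measure set T -> \bar R}) (f : T -> \bar R) :
  (forall A, measurable A -> m A = \int[mu]_(x in A) (g x)%:E) ->
  measurable_fun [set: T] f -> (forall x, 0 <= f x) ->
  \int[m]_x f x = \int[mu]_x (f x * (g x)%:E).
Proof.
move=> mE mf f0; pose h := nnsfun_approx measurableT mf.
have hf x : (h n x)%:E @[n --> \oo] --> f x by exact: cvg_nnsfun_approx.
have h_nd x a b : (a <= b)%N -> (h a x <= h b x)%R.
  by move=> ab; exact/lefP/nd_nnsfun_approx.
have mge : measurable_fun [set: T] (EFin \o g) by exact/measurable_EFinP.
transitivity (limn (fun n => \int[m]_x (h n x)%:E)).
  rewrite -monotone_convergence//.
  - by apply: eq_integral => x _; apply/esym/cvg_lim => //; exact: hf.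
  - by move=> n; exact/measurable_EFinP.
  - by move=> n x _; rewrite lee_fin.
  - by move=> x _ a b ab; rewrite lee_fin h_nd.
transitivity (limn (fun n => \int[mu]_x ((h n x)%:E * (g x)%:E))); last first.
  rewrite -monotone_convergence//.
  - apply: eq_integral => x _; apply/cvg_lim => //.
    by apply: cvgeZr => //; exact: hf.
  - by move=> n; apply: emeasurable_funM => //; exact/measurable_EFinP.
  - by move=> n x _; rewrite mule_ge0 ?lee_fin.
  - by move=> x _ a b ab; rewrite lee_wpmul2r ?lee_fin// h_nd.
congr (limn _); apply/funext => n.
transitivity (\int[m]_x (\sum_(y \in range (h n)) (y * \1_(h n @^-1` [set y]) x)%:E)).
  by apply: eq_integral => x _; rewrite /= fimfunE -fsumEFin.
rewrite ge0_integral_fsum//; last 2 first.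
  - by move=> y; apply/measurable_EFinP; exact: measurable_funM.
  - by move=> y x _; exact: nnfun_muleindic_ge0.
transitivity (\int[mu]_x (\sum_(y \in range (h n))
    (y * \1_(h n @^-1` [set y]) x)%:E * (g x)%:E)); last first.
  apply: eq_integral => x _.
  rewrite -ge0_mule_fsuml => [|y]; last exact: nnfun_muleindic_ge0.
  by rewrite fsumEFin // -(fimfunE _ x).
rewrite ge0_integral_fsum//; last 2 first.
  - move=> y; apply: emeasurable_funM => //; apply/measurable_EFinP.
    exact: measurable_funM.
  - by move=> y x _; apply: mule_ge0; [exact: nnfun_muleindic_ge0|rewrite lee_fin].
apply: eq_fsbigr => r rhn.
under eq_integral do rewrite EFinM.
rewrite integralZl_indic_nnsfun => //.
under [RHS]eq_integral do rewrite EFinM -muleA.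
rewrite ge0_integralZl//.
- under [in RHS]eq_integral do rewrite muleC.
  rewrite [in RHS](eq_integral ((EFin \o g) \_ (h n @^-1` [set r]))); last first.
    by move=> x xE; rewrite epatch_indic.
  by rewrite -integral_mkcond -mE// integral_indic// setIT.
- by apply: emeasurable_funM => //; exact/measurable_EFinP.
- by move=> t Et; rewrite mule_ge0 ?lee_fin.
- by move: rhn; rewrite inE => -[t _ <-]; rewrite lee_fin.
Qed.

End density.

Section finite_borel_unique.
Context {R : realType}.

(** Open left rays form a pi-system that generates the Borel sets. *)
Lemma eq_measure_rays (m1 m2 : {measure set (measurableTypeR R) -> \bar R}) :
  (m1 [set: R] < +oo)%E ->
  (forall x : R, m1 `]-oo, x[%classic = m2 `]-oo, x[%classic) ->
  forall A, measurable A -> m1 A = m2 A.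
Proof.
move=> m1oo m12.
apply: (@measure_unique _ _ (measurableTypeR R) (@RGenInftyO.G R)
  (fun n => `]-oo, n%:R[%classic) (RGenInftyO.measurableE R)).
- move=> _ _ [x ->] [y ->]; exists (Num.min x y).
  apply/predeqP => z /=; rewrite !in_itv/= lt_min.
  by split => [[-> ->]//|/andP[]].
- by move=> n; exists n%:R.
- apply/seteqP; split => // x _.
  exists (Num.truncn `|x|).+1 => //=.
  rewrite in_itv/= (le_lt_trans (ler_norm x))// truncnS_gt//.
- by move=> _ [x ->]; exact: m12.
- by move=> n; rewrite (le_lt_trans _ m1oo)// le_measure// inE.
Qed.

End finite_borel_unique.

(** * Change of variables for Borel functions *)

Section substitution.
Local Open Scope ereal_scope.
Variables (R : realType) (F f : R -> R) (a b : R).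
Hypotheses (ab : (a < b)%R) (cf : continuous f).
Hypothesis dF : forall x : R, is_derive x 1%R F (f x).
Hypothesis F_incr : {in `[a, b] &, {homo F : x y / (x < y)%R}}.
Hypothesis f_ge0 : {in `]a, b[, forall x, (0 <= f x)%R}.
Local Notation leb := (@lebesgue_measure R).

Let cF : continuous F.
Proof.
move=> x; have [dFx _] := dF x.
by apply: differentiable_continuous; exact/derivable1_diffP.
Qed.

Let F_oo t : t \in `]a, b[ -> F t \in `]F a, F b[.
Proof.
rewrite !in_itv/= => /andP[at_ tb].
by rewrite !F_incr ?in_itv/= ?lexx ?(ltW ab) ?(ltW at_) ?(ltW tb).
Qed.

(** The change of variables on a ray: the preimage of the ray is a subinterval
    of [`]a, b[] starting at [a]: empty, full, or ending at the point that [F]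
    maps to [x]; on it the integral of [f] is an increment of [F]. *)
Let measure_substitution (x : R) :
  \int[leb]_(t in F @^-1` `]-oo, x[) ((f \_ `]a, b[) t)%:E =
  \int[leb]_(t in `]-oo, x[) (\1_`]F a, F b[ t)%:E.
Proof.
have Fab : (F a < F b)%R by apply: F_incr => //; rewrite in_itv/= lexx ltW.
have integral_f c : (a < c)%R -> (c <= b)%R ->
    \int[leb]_(t in `]a, c[) (f t)%:E = (F c - F a)%:E.
  by move=> ac cb; exact: integral_derivative_oo.
rewrite integral_indic//=.
have -> : \int[leb]_(t in F @^-1` `]-oo, x[) ((f \_ `]a, b[) t)%:E =
    \int[leb]_(t in (F @^-1` `]-oo, x[) `&` `]a, b[) (f t)%:E.
  by rewrite integral_mkcondr; apply: eq_integral => t _; rewrite restrict_EFin.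
have [xa|ax] := leP x (F a).
  rewrite [X in integral _ X _](_ : _ = set0); last first.
    apply/seteqP; split => // t [/=]; rewrite in_itv/= => Ftx /F_oo.
    by rewrite in_itv/= => /andP[/ltW Fat _]; move: (lt_le_trans Ftx xa); rewrite ltNge Fat.
  rewrite integral_set0 (_ : `]F a, F b[ `&` `]-oo, x[ = set0) ?measure0//.
  apply/seteqP; split => // t [/=]; rewrite !in_itv/= => /andP[Fat _] tx.
  by move: (lt_trans Fat (lt_le_trans tx xa)); rewrite ltxx.
have [bx|xb] := leP (F b) x.
  rewrite [X in integral _ X _](_ : _ = `]a, b[%classic); last first.
    apply/seteqP; split => [t []//|t tab]; split => //=.
    move/F_oo : tab; rewrite !in_itv/= => /andP[_ Ftb].
    exact: lt_le_trans Ftb bx.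
  rewrite integral_f// (_ : `]F a, F b[ `&` `]-oo, x[ = `]F a, F b[%classic).
    by rewrite lebesgue_measure_itv/= lte_fin Fab.
  apply/seteqP; split => [t []//|t tab]; split => //=.
  by move: tab; rewrite /= !in_itv/= => /andP[_ tb]; exact: lt_le_trans tb bx.
have [c cab Fc] : exists2 c, c \in `[a, b] & F c = x.
  apply: IVT; [exact: ltW|exact: continuous_subspaceT|].
  by rewrite (min_l (ltW Fab)) (max_r (ltW Fab)) !ltW.
have {cab} [ac cb] : (a < c)%R /\ (c < b)%R.
  move: cab; rewrite in_itv/= !le_eqVlt => /andP[].
  case: eqVneq => [ac|_ /= ac]; first by move: ax; rewrite -Fc ac ltxx.
  by case: eqVneq => [cb|//]; first by move: xb; rewrite -Fc cb ltxx.
have cab : c \in `[a, b] by rewrite in_itv/= !ltW.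
rewrite [X in integral _ X _](_ : _ = `]a, c[%classic); last first.
  apply/seteqP; split => t /=; rewrite !in_itv/=.
    move=> [Ftx /andP[at_ tb]]; rewrite at_/= ltNge; apply/negP.
    rewrite le_eqVlt => /predU1P[ct|ct]; first by move: Ftx; rewrite -Fc ct ltxx.
    have : (F c < F t)%R by apply: F_incr; rewrite // in_itv/= !ltW.
    by rewrite Fc => /(lt_trans Ftx); rewrite ltxx.
  move=> /andP[at_ tc]; rewrite at_ (lt_trans tc cb); split => //.
  by rewrite -Fc F_incr// in_itv/= !ltW// (lt_trans tc).
rewrite integral_f ?ltW// (_ : `]F a, F b[ `&` `]-oo, x[ = `]F a, x[%classic).
  by rewrite lebesgue_measure_itv/= lte_fin ax Fc.
apply/seteqP; split => t /=; rewrite !in_itv/=.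
  by move=> [/andP[-> _] ->].
by move=> /andP[-> tx]; rewrite tx (lt_trans tx).
Qed.

(** The image under [F] of the measure with density [f] on [`]a, b[] is the
    Lebesgue measure on [`]F a, F b[]: both are finite and agree on rays.  As an
    identity of measures, it covers integrands that are merely measurable. *)
Lemma ge0_integration_by_substitution_oo (G : R -> \bar R) :
  measurable_fun (`]F a, F b[ : set R) G ->
  {in `]F a, F b[, forall x, 0 <= G x} ->
  \int[leb]_(x in `]F a, F b[) G x = \int[leb]_(t in `]a, b[) (G (F t) * (f t)%:E).
Proof.
move=> mG G0.
have mF : measurable_fun [set: measurableTypeR R] (F : _ -> measurableTypeR R).
  exact: continuous_measurable_fun.
have mf : measurable_fun [set: measurableTypeR R] (f \_ `]a, b[).
  apply/(measurable_restrictT _ _).1 => //.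
  by apply: measurable_funTS; exact: continuous_measurable_fun.
have f0 t : (0 <= (f \_ `]a, b[) t)%R.
  by rewrite patchE; case: ifPn => //; rewrite inE => /f_ge0.
have [nu nuE] := exists_density_measure leb mf f0.
have mI : measurable_fun [set: measurableTypeR R] (\1_`]F a, F b[ : _ -> R).
  exact: measurable_indic.
have I0 (t : measurableTypeR R) : (0 <= \1_`]F a, F b[ t :> R)%R by [].
have [la laE] := exists_density_measure leb mI I0.
pose H := G \_ `]F a, F b[.
have mH : measurable_fun [set: measurableTypeR R] H.
  exact/(measurable_restrictT _ _).1.
have H0 x : 0 <= H x.
  by rewrite /H patchE; case: ifPn => //; rewrite inE => /G0.
pose psh := measure_function_pushforward__canonical__measure_function_Measure nu mF.
have pushE A : measurable A -> psh A = la A.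
  apply: (@eq_measure_rays _ psh la) => [|x].
    rewrite /= /pushforward preimage_setT nuE.
    rewrite -[X in integral _ _ X]/(EFin \o (f \_ `]a, b[)) -restrict_EFin.
    by rewrite -integral_mkcond (integral_derivative_oo ab cf dF) ltry.
  by rewrite /= /pushforward nuE laE; exact: measure_substitution.
transitivity (\int[la]_x H x).
  rewrite (ge0_integral_density mI I0 (fun A _ => laE A))// [LHS]integral_mkcond.
  apply: eq_integral => x _; rewrite /H !patchE indicE; case: ifPn => _.
    by rewrite mule1.
  by rewrite mul0e.
transitivity (\int[psh]_x H x).
  by apply: eq_measure_integral => A mA _; rewrite -pushE.
rewrite ge0_integral_pushforward//= preimage_setT.
rewrite (ge0_integral_density mf f0 (fun A _ => nuE A))//; last exact: measurableT_comp.
rewrite [RHS]integral_mkcond.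
apply: eq_integral => t _; rewrite /= !patchE; case: ifPn => tab; last by rewrite mule0.
by rewrite /H patchE; rewrite inE/= in tab; rewrite mem_set//=; exact: F_oo.
Qed.

End substitution.

(** * The arcsine substitution *)

Section arcsine_substitution.
Variable R : realType.
Local Notation leb := (@lebesgue_measure R).
Implicit Types (a b t : R) (G : R -> R).

(** Chosen so that [dx / sqrt((x - a)(b - x))] becomes [dt] on [`]0, pi[]. *)
Definition sin2_half a b t : R := a + (b - a) * sin (t / 2) ^+ 2.

Lemma half_pi_itv t : t \in `]0, pi[ -> 0 < sin (t / 2) /\ 0 < cos (t / 2).
Proof.
rewrite in_itv/= => /andP[t0 tpi]; split.
  by apply: sin_gt0_pihalf; rewrite divr_gt0//= ltr_pM2r.
apply: cos_gt0_pihalf; rewrite ltr_pM2r// tpi andbT.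
by rewrite (@lt_trans _ _ 0)// ?oppr_lt0 divr_gt0// pi_gt0.
Qed.

Lemma is_derive_sin2_half a b t :
  is_derive t 1 (sin2_half a b) ((b - a) * (sin (t / 2) * cos (t / 2))).
Proof.
have ds := is_derive_sin_half t.
apply: (trigger_derive (f := fun t => a + (b - a) * (sin (t / 2) * sin (t / 2)))).
by rewrite /GRing.scale/=; field.
Qed.

Lemma continuous_sin2_half_derivative a b :
  continuous (fun t => (b - a) * (sin (t / 2) * cos (t / 2))).
Proof.
have ch : continuous (fun t : R => t / 2).
  by move=> t; apply: cvgM; [exact: cvg_id|exact: cvg_cst].
have cs : continuous (fun t : R => sin (t / 2)).
  by move=> t; apply: continuous_comp; [exact: ch|exact: continuous_sin].
have cc : continuous (fun t : R => cos (t / 2)).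
  by move=> t; apply: continuous_comp; [exact: ch|exact: continuous_cos].
by move=> t; apply: cvgM; [exact: cvg_cst|apply: cvgM; [exact: cs|exact: cc]].
Qed.

Lemma sin2_half0 a b : sin2_half a b 0 = a.
Proof. by rewrite /sin2_half mul0r sin0 expr0n mulr0 addr0. Qed.

Lemma sin2_half_pi a b : sin2_half a b pi = b.
Proof. by rewrite /sin2_half sin_pihalf expr1n mulr1 addrC subrK. Qed.

Lemma sin2_half_incr a b : a < b ->
  {in `[0, pi] &, {homo sin2_half a b : x y / x < y}}.
Proof.
move=> ab x y; rewrite !in_itv/= => /andP[x0 xpi] /andP[y0 ypi] xy.
rewrite /sin2_half ltrD2l ltr_pM2l ?subr_gt0//.
have p2 : -(pi / 2) <= 0 :> R by rewrite oppr_le0 divr_ge0// pi_ge0.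
have h (z : R) : 0 <= z -> z <= pi -> z / 2 \in `[- (pi / 2), pi / 2].
  move=> z0 zpi; rewrite in_itv/=; apply/andP; split.
    by apply: le_trans p2 _; rewrite divr_ge0.
  by rewrite ler_pM2r.
have xy2 : sin (x / 2) < sin (y / 2) by rewrite ltr_sin ?h// ltr_pM2r.
have x0' : 0 <= sin (x / 2).
  by apply: sin_ge0_pi; rewrite divr_ge0//= ler_pdivrMr//; have := pi_ge0 R; lra.
by rewrite ltrXn2r// ?nnegrE// (le_trans x0')// ltW.
Qed.

Lemma sin2_half_itv a b t : a < b -> t \in `]0, pi[ -> sin2_half a b t \in `]a, b[.
Proof.
move=> ab; rewrite !in_itv/= => /andP[t0 tpi].
have mem (u : R) : 0 <= u -> u <= pi -> u \in `[0, pi] by rewrite in_itv/= => -> ->.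
have := sin2_half_incr ab (mem 0 (lexx _) (pi_ge0 R)) (mem t (ltW t0) (ltW tpi)) t0.
have := sin2_half_incr ab (mem t (ltW t0) (ltW tpi)) (mem pi (pi_ge0 R) (lexx _)) tpi.
by rewrite sin2_half0 sin2_half_pi => -> ->.
Qed.

Lemma measurable_sin2_half a b : measurable_fun [set: R] (sin2_half a b).
Proof.
apply: continuous_measurable_fun => t.
have [dt _] := is_derive_sin2_half a b t.
by apply: differentiable_continuous; exact/derivable1_diffP.
Qed.

Lemma measurable_comp_sin2_half a b G : a < b ->
  measurable_fun `]a, b[ G -> measurable_fun `]0, pi[ (G \o sin2_half a b).
Proof.
move=> ab mG; apply: (@measurable_comp _ _ _ _ _ _ `]a, b[) => //.
- by move=> _ [t tpi <-]; exact: sin2_half_itv.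
- by apply: measurable_funTS; exact: measurable_sin2_half.
Qed.

Lemma sqrt_sin2_half a b t : a < b -> t \in `]0, pi[ ->
  Num.sqrt ((sin2_half a b t - a) * (b - sin2_half a b t)) =
  (b - a) * (sin (t / 2) * cos (t / 2)).
Proof.
move=> ab tpi; have [s0 c0] := half_pi_itv tpi.
rewrite (_ : _ * _ = ((b - a) * (sin (t / 2) * cos (t / 2))) ^+ 2).
  by rewrite sqrtr_sqr ger0_norm// !mulr_ge0 ?subr_ge0// ltW.
have c2 : cos (t / 2) ^+ 2 = 1 - sin (t / 2) ^+ 2 by rewrite cos2sin2.
rewrite !exprMn c2 /sin2_half; ring.
Qed.

Lemma measurable_arcsine_weight a b :
  measurable_fun `]a, b[ (fun x : R => (Num.sqrt ((x - a) * (b - x)))^-1).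
Proof.
apply: open_continuous_measurable_fun; first exact: interval_open.
move=> x; rewrite inE/= in_itv/= => /andP[ax xb].
apply: (@cvgV _ _ _ (nbhs_filter x) (fun x : R => Num.sqrt ((x - a) * (b - x)))).
  by rewrite gt_eqF// sqrtr_gt0 mulr_gt0// subr_gt0.
apply: (@continuous_comp _ _ _ (fun y : R => ((y - a) * (b - y))%R) Num.sqrt);
  last exact: sqrt_continuous.
by apply: cvgM; apply: cvgB; (exact: cvg_id || exact: cvg_cst).
Qed.

(** The weight of the left-hand side is the inverse of the derivative of the
    substitution, so only a change of variables with a bounded derivative is
    used although the weight is singular at both ends. *)
Lemma ge0_arcsine_substitution a b G : a < b -> measurable_fun `]a, b[ G ->
  {in `]a, b[, forall x, 0 <= G x} ->
  (\int[leb]_(x in `]a, b[) (G x / Num.sqrt ((x - a) * (b - x)))%:E =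
   \int[leb]_(t in `]0%R, pi[) (G (sin2_half a b t))%:E)%E.
Proof.
move=> ab mG G0; rewrite -{1}(sin2_half0 a b) -{2}(sin2_half_pi a b).
rewrite (ge0_integration_by_substitution_oo (pi_gt0 R)
  (@continuous_sin2_half_derivative a b) (is_derive_sin2_half a b) (sin2_half_incr ab)).
- apply: eq_integral => t; rewrite inE/= => tpi; rewrite sqrt_sin2_half// -EFinM.
  have [s0 c0] := half_pi_itv tpi.
  by rewrite mulfVK// gt_eqF// !mulr_gt0 ?subr_gt0.
- move=> t /half_pi_itv[s0 c0].
  by rewrite !mulr_ge0 ?subr_ge0// ltW.
- rewrite sin2_half0 sin2_half_pi; apply/measurable_EFinP.
  by apply: measurable_funM => //; exact: measurable_arcsine_weight.
- move=> x; rewrite sin2_half0 sin2_half_pi => xab.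
  by rewrite lee_fin divr_ge0 ?G0 ?sqrtr_ge0.
Qed.

(** The positive and the negative parts of both integrands correspond to each
    other, so the signed identity follows from the nonnegative one. *)
Lemma arcsine_substitution a b G : a < b -> measurable_fun `]a, b[ G ->
  (\int[leb]_(x in `]a, b[) (G x / Num.sqrt ((x - a) * (b - x)))%:E =
   \int[leb]_(t in `]0%R, pi[) (G (sin2_half a b t))%:E)%E.
Proof.
move=> ab mG; rewrite [LHS]integralE [RHS]integralE.
have sub (H : R -> R) : measurable_fun `]a, b[ H -> (forall x, 0 <= H x) ->
  (\int[leb]_(x in `]a, b[) (H x / Num.sqrt ((x - a) * (b - x)))%:E =
   \int[leb]_(t in `]0%R, pi[) (H (sin2_half a b t))%:E)%E.
  by move=> mH H0; apply: ge0_arcsine_substitution => // x _; exact: H0.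
congr (_ - _)%E.
- transitivity (\int[leb]_(t in `]0%R, pi[) (Num.max (G (sin2_half a b t)) 0)%:E)%E.
    rewrite -(sub (fun x => Num.max (G x) 0)).
    + apply: eq_integral => x _; rewrite funeposE -EFin_max.
      by rewrite maxr_pMl ?mul0r// invr_ge0 sqrtr_ge0.
    + exact: measurable_funrpos.
    + by move=> x; rewrite le_max lexx orbT.
  by apply: eq_integral => t _; rewrite funeposE -EFin_max.
- transitivity (\int[leb]_(t in `]0%R, pi[) (Num.max (- G (sin2_half a b t)) 0)%:E)%E.
    rewrite -(sub (fun x => Num.max (- G x) 0)).
    + apply: eq_integral => x _; rewrite funenegE -EFinN -EFin_max.
      by rewrite -mulNr maxr_pMl ?mul0r// invr_ge0 sqrtr_ge0.
    + exact: measurable_funrneg.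
    + by move=> x; rewrite le_max lexx orbT.
  by apply: eq_integral => t _; rewrite funenegE -EFinN -EFin_max.
Qed.

Lemma integrable_arcsine_substitution a b G : a < b -> measurable_fun `]a, b[ G ->
  leb.-integrable `]a, b[ (EFin \o (fun x => G x / Num.sqrt ((x - a) * (b - x)))) ->
  leb.-integrable `]0, pi[ (EFin \o (G \o sin2_half a b)).
Proof.
move=> ab mG /integrableP[_ iG]; apply/integrableP; split.
  by apply/measurable_EFinP; exact: measurable_comp_sin2_half.
apply: le_lt_trans iG; rewrite le_eqVlt; apply/orP; left; apply/eqP.
rewrite -[LHS](@ge0_arcsine_substitution a b (fun x => `|G x|))//.
- apply: eq_integral => x _; rewrite abse_EFin normrM.
  by rewrite [X in _ = (_ * X)%:E]ger0_norm// invr_ge0 sqrtr_ge0.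
- exact: measurableT_comp.
Qed.

Lemma ge0_integral_arcsine_measure (G : R -> R) :
  measurable_fun (`]0, 1[ : set R) G -> (forall x, 0 <= G x) ->
  (\int[@arcsine_measure R]_x ((G \_ `]0%R, 1%R[) x)%:E =
   \int[leb]_(t in `]0%R, pi[) (G (sin (t / 2) ^+ 2))%:E)%E.
Proof.
move=> mG G0.
have md : measurable_fun [set: measurableTypeR R]
    ((@arcsine_density R) \_ `]0, 1[ : _ -> R).
  by apply/(measurable_restrictT _ _).1 => //; exact: measurable_arcsine_density.
have d0 x : 0 <= ((@arcsine_density R) \_ `]0, 1[) x.
  by rewrite patchE; case: ifPn => // _; rewrite /arcsine_density invr_ge0 sqrtr_ge0.
rewrite (ge0_integral_density md d0 (mu := leb)).
- transitivity (\int[leb]_(x in `]0%R, 1%R[) (G x / Num.sqrt ((x - 0) * (1 - x)))%:E)%E.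
    rewrite [RHS]integral_mkcond; apply: eq_integral => x _.
    rewrite !patchE; case: ifPn => _; last by rewrite mule0.
    by rewrite -EFinM subr0.
  rewrite arcsine_substitution//; apply: eq_integral => t _.
  by rewrite /sin2_half subr0 mul1r add0r.
- move=> A mA; rewrite /= /arcsine_measure integral_mkcondr; apply: eq_integral => x _.
  by rewrite restrict_EFin.
- by apply/measurable_EFinP/(measurable_restrictT _ _).1.
- by move=> x; rewrite lee_fin patchE; case: ifPn.
Qed.

End arcsine_substitution.

(** * The Mehler-Dirichlet formula *)

Section kernel.
Variable R : realType.
Local Notation leb := (@lebesgue_measure R).

(** Zero on the negative half-line, so that the Abel kernel
    [inv_sqrt (x - y)] incorporates the constraint [y < x]. *)
Definition inv_sqrt (x : R) : R := (Num.sqrt x)^-1.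

Lemma inv_sqrt_ge0 x : 0 <= inv_sqrt x.
Proof. by rewrite invr_ge0 sqrtr_ge0. Qed.

Lemma inv_sqrt_le0 x : x <= 0 -> inv_sqrt x = 0.
Proof. by move=> x0; rewrite /inv_sqrt ler0_sqrtr// invr0. Qed.

Lemma inv_sqrtM x y : 0 <= x -> inv_sqrt (x * y) = inv_sqrt x * inv_sqrt y.
Proof. by move=> x0; rewrite /inv_sqrt sqrtrM// invfM. Qed.

Lemma measurable_inv_sqrt : measurable_fun [set: R] inv_sqrt.
Proof.
have -> : inv_sqrt = inv_sqrt \_ `]0, +oo[.
  apply/funext => x; rewrite patchE; case: ifPn => //.
  by rewrite notin_setE/= in_itv/= andbT => /negP; rewrite -leNgt => /inv_sqrt_le0.
apply/(measurable_restrictT _ _).1 => //.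
apply: open_continuous_measurable_fun; first exact: interval_open.
move=> x; rewrite inE/= in_itv/= andbT => x0.
by apply: cvgV; [rewrite gt_eqF// sqrtr_gt0|exact: sqrt_continuous].
Qed.

Lemma continuous_airfoil n : continuous (@airfoil R n).
Proof.
have -> : airfoil n =
    horner (\sum_(k < n.+1) ((- 4) ^+ k * 'C(n + k, k.*2)%:R) *: 'X^k) :> (R -> R).
  apply/funext => u; rewrite horner_sum; apply: eq_bigr => k _.
  by rewrite hornerZ hornerXn.
exact: continuous_horner.
Qed.

(** A crude bound on [`[0, 1]]; any bound that does not depend on the point is
    enough to apply Fubini. *)
Definition airfoil_bound n : R := \sum_(k < n.+1) `|(- 4) ^+ k * 'C(n + k, k.*2)%:R|.

Lemma airfoil_le n u : 0 <= u -> u <= 1 -> `|airfoil n u| <= airfoil_bound n.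
Proof.
move=> u0 u1; apply: le_trans (ler_norm_sum _ _ _) _; apply: ler_sum => k _.
by rewrite normrM ler_piMr// ger0_norm ?exprn_ge0// exprn_ile1.
Qed.

Lemma airfoil_bound_ge0 n : 0 <= airfoil_bound n.
Proof. by apply: sumr_ge0 => k _. Qed.

Let cos2_half_sub y t : 1 - sin2_half y 1 t = (1 - y) * cos (t / 2) ^+ 2 :> R.
Proof. by rewrite /sin2_half cos2sin2; ring. Qed.

Let continuous_one_sub : continuous (fun x : R => 1 - x).
Proof. by move=> x; apply: cvgB; [exact: cvg_cst|exact: cvg_id]. Qed.

Let measurable_airfoil n D : measurable D ->
  measurable_fun D (fun x : R => airfoil n (1 - x)).
Proof.
move=> mD; apply: measurable_funTS; apply: continuous_measurable_fun => x.
apply: (@continuous_comp _ _ _ (fun x : R => 1 - x) (airfoil n)).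
  exact: continuous_one_sub.
exact: continuous_airfoil.
Qed.

(** Under the arcsine substitution from [y] to 1, [1 - x] becomes
    [(1 - y) cos^2(t/2)], and each power of [1 - x] contributes one Wallis
    moment; these are the coefficients of the Legendre polynomial in powers of
    [1 - y]. *)
Lemma mehler_dirichlet n (y : R) : y < 1 ->
  (\int[leb]_(x in `]y, 1%R[) (airfoil n (1 - x) / Num.sqrt ((x - y) * (1 - x)))%:E =
   (pi * (legendre R n).[2 * y - 1])%:E)%E.
Proof.
move=> y1; rewrite (arcsine_substitution y1 (G := fun x => airfoil n (1 - x))); last first.
  exact: measurable_airfoil.
pose c k : R := (- 4) ^+ k * 'C(n + k, k.*2)%:R * (1 - y) ^+ k.
transitivity (\int[leb]_(t in `]0%R, pi[)
    \sum_(k < n.+1) (c k * cos (t / 2) ^+ k.*2)%:E)%E.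
  apply: eq_integral => t _; rewrite cos2_half_sub /airfoil sumEFin; congr EFin.
  by apply: eq_bigr => k _; rewrite exprMn -exprM mul2n mulrA.
rewrite integral_sum//; last first.
  move=> k; apply: continuous_integrable_oo => t.
  by apply: cvgM; [exact: cvg_cst|exact: continuous_cos_half_exp].
rewrite legendre_expansion mulr_sumr -sumEFin; apply: eq_bigr => k _.
have ic := continuous_integrable_oo 0 pi (@continuous_cos_half_exp R k.*2).
rewrite -(@fineK _ (integral _ _ _)); last first.
  apply: integrable_fin_num => //; apply: continuous_integrable_oo => t.
  by apply: cvgM; [exact: cvg_cst|exact: continuous_cos_half_exp].
congr EFin; rewrite -[LHS]/(Rintegral _ _ _) RintegralZl// -/(cos_moment _ _).
rewrite /c (_ : - 4 = -1 * 4) ?exprMn; last by ring.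
transitivity ((-1) ^+ k * (1 - y) ^+ k * (4 ^+ k * 'C(n + k, k.*2)%:R * cos_moment R k)).
  by ring.
have kn : (k <= n)%N by rewrite -ltnS.
by rewrite cos_moment_binomial//; ring.
Qed.

(** Uniform in [y]: the total mass of [dx / sqrt((x - y)(1 - x))] on [`]y, 1[]
    is always [pi]. *)
Lemma mehler_dirichlet_abs n (y : R) : y < 1 -> 0 <= y ->
  (\int[leb]_(x in `]y, 1%R[) (`|airfoil n (1 - x)| / Num.sqrt ((x - y) * (1 - x)))%:E
   <= (airfoil_bound n * pi)%:E)%E.
Proof.
move=> y1 y0.
rewrite (ge0_arcsine_substitution y1 (G := fun x => `|airfoil n (1 - x)|))//; last first.
  by apply: measurableT_comp => //; exact: measurable_airfoil.
apply: (@le_trans _ _ (\int[leb]_(t in `]0%R, pi[) (airfoil_bound n)%:E)%E).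
  apply: ge0_le_integral => //.
  - apply/measurable_EFinP; apply: measurableT_comp => //.
    apply: (measurable_comp_sin2_half (G := fun x => airfoil n (1 - x)) y1).
    exact: measurable_airfoil.
  - move=> t /= tpi; rewrite lee_fin; apply: airfoil_le.
      by have := sin2_half_itv y1 tpi; rewrite in_itv/= subr_ge0 => /andP[_ /ltW].
    have := sin2_half_itv y1 tpi; rewrite in_itv/= => /andP[yt _].
    by rewrite lerBlDr lerDl (le_trans y0)// ltW.
rewrite integral_cst//= lebesgue_measure_itv/= lte_fin pi_gt0.
by rewrite -EFinM lee_fin subr0.
Qed.

End kernel.

(** * The Abel transform against the Chebyshev kernel *)

Section abel_legendre.
Variables (R : realType) (f : R -> R) (n : nat).
Hypothesis mf : measurable_fun (`]0, 1[ : set R) f.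
Local Notation leb := (@lebesgue_measure R).
Local Notation mR := (measurableTypeR R).
Hypothesis fi : leb.-integrable (`]0, 1[ : set R) (EFin \o f).

Let f0 : R -> R := f \_ `]0, 1[.
Let K (x : R) : R := airfoil n (1 - x) * inv_sqrt (1 - x).

Let mf0 : measurable_fun [set: mR] f0.
Proof. exact/(measurable_restrictT _ _).1. Qed.

Let mK : measurable_fun [set: mR] K.
Proof.
have m1 : measurable_fun [set: mR] (fun x : R => 1 - x).
  by apply: measurable_funB => //.
apply: measurable_funM.
  apply: measurableT_comp m1; apply: continuous_measurable_fun.
  exact: continuous_airfoil.
by apply: measurableT_comp m1; exact: measurable_inv_sqrt.
Qed.

Let A (z : mR * mR) : R := f0 z.2 * inv_sqrt (z.1 - z.2).

Let mA : measurable_fun [set: mR * mR] A.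
Proof.
apply: measurable_funM.
  by apply: measurableT_comp mf0 _; exact: measurable_snd.
apply: measurableT_comp; first exact: measurable_inv_sqrt.
by apply: measurable_funB; [exact: measurable_fst|exact: measurable_snd].
Qed.

Let H (z : mR * mR) : \bar R := (A z * K z.1)%:E.

Let mH : measurable_fun [set: mR * mR] H.
Proof.
apply/measurable_EFinP; apply: measurable_funM => //.
by apply: measurableT_comp mK _; exact: measurable_fst.
Qed.

Lemma abel_restrict x : x < 1 -> abel f x = \int[leb]_y A (x, y).
Proof.
move=> x1; rewrite /abel Rintegral_mkcond; apply: eq_Rintegral => y _.
rewrite patchE /A/= /f0 patchE; case: ifPn => [|yx].
  rewrite inE/= in_itv/= => /andP[y0 yx].
  by rewrite ifT// inE/= in_itv/= y0 (lt_trans yx).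
case: ifPn => [|_]; last by rewrite mul0r.
rewrite inE/= in_itv/= => /andP[y0 y1].
move: yx; rewrite notin_setE/= in_itv/= y0/= => /negP; rewrite -leNgt => xy.
by rewrite inv_sqrt_le0 ?mulr0// subr_le0.
Qed.

Lemma measurable_abel : measurable_fun (`]0, 1[ : set R) (abel f).
Proof.
apply: (@eq_measurable_fun _ _ _ _ _ (fun x => \int[leb]_y A (x, y))).
  by move=> x; rewrite inE/= in_itv/= => /andP[_ x1]; rewrite abel_restrict.
apply: measurable_funTS; rewrite /Rintegral.
apply: (measurableT_comp (f := fine)); first exact: fine_measurable.
have mAe : measurable_fun [set: mR * mR] (EFin \o A) by exact/measurable_EFinP.
have -> : (fun x => \int[leb]_y (A (x, y))%:E)%E =
  ((fun x => \int[leb]_y (EFin \o A)^\+ (x, y)) \- (fun x => \int[leb]_y (EFin \o A)^\- (x, y)))%E.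
  apply/funext => x; rewrite [LHS]integralE.
  by congr (_ - _)%E; apply: eq_integral => y _; rewrite !(funeposE, funenegE).
apply: emeasurable_funB.
  apply: (measurable_fun_fubini_tonelli_F (EFin \o A)^\+%E) => //.
  exact: measurable_funepos.
apply: (measurable_fun_fubini_tonelli_F (EFin \o A)^\-%E) => //.
exact: measurable_funeneg.
Qed.

(** The factor of [f y] after the exchange of the integrals; [K] vanishes for
    [x >= 1] and [inv_sqrt (x - y)] for [x <= y], hence it lives on [`]y, 1[]. *)
Let kern (y x : R) : R := inv_sqrt (x - y) * K x.
Let g (y x : R) : R := airfoil n (1 - x) / Num.sqrt ((x - y) * (1 - x)).

Let kern_restrict (y x : R) : kern y x = (g y \_ `]y, 1[) x.
Proof.
rewrite patchE; case: ifPn.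
  rewrite inE/= in_itv/= => /andP[yx x1].
  by rewrite /kern /K mulrCA -inv_sqrtM// subr_ge0 ltW.
rewrite notin_setE/= in_itv/= => /negP; rewrite negb_and -!leNgt /kern.
move=> /orP[xy|x1]; first by rewrite inv_sqrt_le0 ?mul0r// subr_le0.
by rewrite /K [inv_sqrt (1 - x)]inv_sqrt_le0 ?mulr0// subr_le0.
Qed.

Let mkern (y : R) : measurable_fun [set: mR] (kern y).
Proof.
apply: measurable_funM => //; apply: measurableT_comp; first exact: measurable_inv_sqrt.
exact: measurable_funB.
Qed.

Let kern_abs (y : R) : 0 < y < 1 ->
  (\int[leb]_x `|(kern y x)%:E| <= (airfoil_bound R n * pi)%:E)%E.
Proof.
move=> /andP[y0 y1]; apply: le_trans (mehler_dirichlet_abs n y1 (ltW y0)).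
rewrite [leRHS]integral_mkcond le_eqVlt; apply/orP; left; apply/eqP.
apply: eq_integral => x _; rewrite kern_restrict !patchE; case: ifPn => _.
  by rewrite abse_EFin /g normrM (ger0_norm (inv_sqrt_ge0 _)).
by rewrite abse0.
Qed.

Let kern_integrable (y : R) : 0 < y < 1 ->
  leb.-integrable [set: mR] (EFin \o kern y).
Proof.
move=> y01; apply/integrableP; split; first exact/measurable_EFinP.
by apply: le_lt_trans (kern_abs y01) _; rewrite ltry.
Qed.

Let kern_integral (y : R) : 0 < y < 1 ->
  (\int[leb]_x (kern y x)%:E = (pi * (legendre R n).[2 * y - 1])%:E)%E.
Proof.
move=> /andP[y0 y1]; rewrite -(mehler_dirichlet n y1) [RHS]integral_mkcond.
apply: eq_integral => x _; rewrite kern_restrict -[RHS]/((EFin \o g y) \_ _ x).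
by rewrite restrict_EFin.
Qed.

Let HE (x y : R) : H (x, y) = (f0 y * kern y x)%:E.
Proof. by rewrite /H /A /= -mulrA. Qed.

Let f00 (y : R) : ~~ (0 < y < 1) -> f0 y = 0.
Proof. by move=> y01; rewrite /f0 patchE memNset//= in_itv/=; exact/negP. Qed.

Let if0 : leb.-integrable [set: mR] (EFin \o f0).
Proof. by rewrite /f0 -restrict_EFin; apply/integrable_restrict; rewrite //= setTI. Qed.

Let integral_H2 (y : R) : (\int[leb]_x H (x, y) =
  (f0 y * (pi * (legendre R n).[2 * y - 1]))%:E)%E.
Proof.
under eq_integral do rewrite HE.
have [y01|y01] := boolP (0 < y < 1); last first.
  by rewrite f00// mul0r; apply: integral0_eq => x _; rewrite mul0r.
rewrite EFinM -kern_integral//; under eq_integral do rewrite EFinM.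
by rewrite integralZl//; exact: kern_integrable.
Qed.

(** Integrating in [x] first, the bound on the kernel leaves a multiple of
    [`|f y|], which is integrable. *)
Let iH : (leb \x leb)%E.-integrable [set: mR * mR] H.
Proof.
apply/integrable21ltyP => //.
apply: (@le_lt_trans _ _ (\int[leb]_y ((airfoil_bound R n * pi)%:E * `|(f0 y)%:E|))%E).
  apply: ge0_le_integral => //.
  - by move=> y _; exact: integral_ge0.
  - apply: (measurable_fun_fubini_tonelli_G (abse \o H)) => //=.
    exact: measurableT_comp.
  - apply: emeasurable_funM => //; apply: measurableT_comp => //.
    exact/measurable_EFinP.
  - move=> y _; under eq_integral do rewrite HE.
    have [y01|y01] := boolP (0 < y < 1); last first.
      rewrite f00// integral0_eq; last by move=> x _; rewrite mul0r abse0.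
      by rewrite mule_ge0// lee_fin mulr_ge0 ?airfoil_bound_ge0 ?pi_ge0.
    under eq_integral do rewrite EFinM abseM.
    rewrite ge0_integralZl//; last first.
      by apply: measurableT_comp => //; exact/measurable_EFinP.
    by rewrite muleC lee_wpmul2r// kern_abs.
rewrite ge0_integralZl//; last 2 first.
  by apply: measurableT_comp => //; exact/measurable_EFinP.
  by rewrite lee_fin mulr_ge0 ?airfoil_bound_ge0 ?pi_ge0.
rewrite lte_mul_pinfty//; first by rewrite lee_fin mulr_ge0 ?airfoil_bound_ge0 ?pi_ge0.
by have /integrableP[] := if0.
Qed.

Let aw (x : R) : R := abel f x * K x.

(** Only almost everywhere: the Abel integral need not converge at every
    point.  Where [K] does not vanish, integrability of the section of [H]
    yields that of the Abel integrand, so that [K x] can be factored out. *)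
Let ae_fubini_F :
  ae_eq leb [set: mR] (fubini_F leb H) (EFin \o (aw \_ `]0, 1[)).
Proof.
move: (ae_integrable1 iH); apply: filterS => x /= iHx _.
rewrite /fubini_F patchE; case: ifPn; last first.
  rewrite notin_setE/= in_itv/= => /negP x01.
  apply: integral0_eq => y _; rewrite HE.
  have [y01|y01] := boolP (0 < y < 1); last by rewrite f00// mul0r.
  rewrite kern_restrict patchE memNset ?mulr0//= in_itv/= => /andP[yx x1].
  by move: x01; rewrite x1 andbT (lt_trans _ yx)//; case/andP: y01.
rewrite inE/= in_itv/= => /andP[x0 x1]; rewrite /aw abel_restrict//.
have [Kx0|Kx0] := eqVneq (K x) 0.
  by rewrite Kx0 mulr0; apply: integral0_eq => y _; rewrite /H Kx0 mulr0.
have iA : leb.-integrable [set: mR] (EFin \o (fun y => A (x, y))).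
  have := integrableZr measurableT (K x)^-1 iHx.
  apply: eq_integrable => // y _; rewrite /H /= -EFinM mulfK//.
rewrite -RintegralZr// fineK//; apply: integrable_fin_num => //.
Qed.

Let maw : measurable_fun [set: mR] (EFin \o (aw \_ `]0, 1[)).
Proof.
apply/measurable_EFinP/(measurable_restrictT _ _).1 => //.
by apply: measurable_funM; [exact: measurable_abel|exact: measurable_funTS].
Qed.

Lemma integrable_abel_airfoil :
  leb.-integrable (`]0, 1[ : set R) (EFin \o aw).
Proof.
apply/integrable_mkcond => //; rewrite restrict_EFin.
have /integrableP[mF iF] := integrable_fubini_F iH.
apply/integrableP; split => //; apply: le_lt_trans iF.
rewrite le_eqVlt; apply/orP; left; apply/eqP; apply: ae_eq_integral => //.
- exact: measurableT_comp.
- exact: measurableT_comp.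
- by apply: filterS ae_fubini_F => x Hx _; rewrite (Hx I).
Qed.

Let iG : leb.-integrable [set: mR] (fubini_G leb H).
Proof.
apply/integrableP; split; first exact: measurable_fubini_G iH.
have Hoo := (integrable21ltyP _ _ mH).1 iH.
apply: le_lt_trans Hoo; apply: ge0_le_integral => //.
- by apply: measurableT_comp => //; exact: measurable_fubini_G iH.
- by apply: (measurable_fun_fubini_tonelli_G (abse \o H)) => //=; exact: measurableT_comp.
- by move=> y _; apply: le_abse_integral => //; exact: measurableT_comp.
Qed.

Let P (y : R) := (legendre R n).[2 * y - 1].

Let iP : leb.-integrable (`]0, 1[ : set R) (EFin \o (fun y => pi * (f y * P y))).
Proof.
apply/integrable_mkcond => //; rewrite restrict_EFin.
apply: eq_integrable iG => // y _.
rewrite /fubini_G integral_H2 /= /f0 !patchE; case: ifPn => _; last by rewrite mul0r.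
by rewrite mulrCA.
Qed.

Lemma integrable_mul_legendre : leb.-integrable (`]0, 1[ : set R)
  (EFin \o (fun y => f y * (legendre R n).[2 * y - 1])).
Proof.
have mI : measurable (`]0, 1[ : set mR) by exact: measurable_itv.
have := integrableZr mI pi^-1 iP.
apply: eq_integrable => // y _ /=.
by rewrite -EFinM mulrC mulKf// gt_eqF// pi_gt0.
Qed.

(** Fubini, then the Mehler-Dirichlet formula for the inner integral. *)
Lemma integral_abel_airfoil :
  \int[leb]_(x in `]0, 1[) aw x =
  pi * \int[leb]_(y in `]0, 1[) (f y * (legendre R n).[2 * y - 1]).
Proof.
rewrite -RintegralZl//; last exact: integrable_mul_legendre.
rewrite /Rintegral; congr fine.
transitivity (\int[leb]_x fubini_F leb H x)%E.
  rewrite integral_mkcond; apply: ae_eq_integral => //.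
  - by rewrite restrict_EFin.
  - exact: measurable_fubini_F iH.
  - by apply: filterS ae_fubini_F => x Hx _; rewrite restrict_EFin (Hx I).
have := Fubini iH; rewrite /fubini_F => ->.
rewrite [RHS]integral_mkcond; apply: eq_integral => y _.
rewrite integral_H2 /= /f0 !patchE; case: ifPn => _; last by rewrite mul0r.
by rewrite mulrCA.
Qed.

End abel_legendre.

(** * Even and odd integrands *)

Section parity.
Variable R : realType.
Local Notation leb := (@lebesgue_measure R).
Local Notation mR := (measurableTypeR R).
Implicit Types (u : R -> R) (v : R -> \bar R) (a : R).

Let mopp : measurable_fun [set: mR] (-%R : mR -> mR).
Proof. by apply: continuous_measurable_fun; exact: opp_continuous. Qed.

Lemma ge0_integralN v : measurable_fun [set: mR] v -> (forall x, 0 <= v x)%E ->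
  (\int[leb]_x v (- x)%R = \int[leb]_x v x)%E.
Proof.
move=> mv v0; rewrite -[LHS]/(\int[leb]_(x in -%R @^-1` [set: mR]) (v \o -%R) x)%E.
rewrite -(ge0_integral_pushforward mopp)//=.
pose psh := measure_function_pushforward__canonical__measure_function_Measure leb mopp.
apply: (@eq_measure_integral _ _ _ _ leb psh) => B mB _.
exact: lebesgue_measureN.
Qed.

Lemma integralN v : measurable_fun [set: mR] v ->
  (\int[leb]_x v (- x)%R = \int[leb]_x v x)%E.
Proof.
move=> mv; rewrite [LHS]integralE [RHS]integralE; congr (_ - _)%E.
- rewrite -(ge0_integralN (measurable_funepos mv))//.
  by apply: eq_integral => x _; rewrite !funeposE.
- rewrite -(ge0_integralN (measurable_funeneg mv))//.
  by apply: eq_integral => x _; rewrite !funenegE.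
Qed.

(** Reduces measurability and integrability on [`]- a, a[] to [`]0, a[]; the
    cases of interest are [s = 1] and [s = -1]. *)
Lemma symmetric_restrict (s : R) u a : (forall t, u (- t) = s * u t) -> u 0 = 0 ->
  u \_ `]- a, a[ = (fun t => (u \_ `]0, a[) t + s * (u \_ `]0, a[) (- t)).
Proof.
move=> us u0; apply/funext => t; rewrite !patchE !mem_setE !in_itv/=.
rewrite oppr_gt0 ltrNl.
have p0 : point = 0 :> R by [].
rewrite p0; have [t0|t0|<-] := ltgtP 0 t.
- rewrite /= mulr0 addr0 (_ : _ && _ = (t < a))//.
  by apply: andb_idl; apply: lt_trans; rewrite (@lt_trans _ _ 0)// oppr_lt0.
- rewrite /= add0r (_ : _ && _ = (- t < a)).
    by case: ifPn => _; rewrite ?mulr0// -us opprK.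
  by apply: andb_idr; apply: lt_trans; rewrite (@lt_trans _ _ 0)// oppr_gt0.
- by rewrite /= mulr0 addr0 u0; case: ifPn.
Qed.

Lemma measurable_symmetric (s : R) u a :
  (forall t, u (- t) = s * u t) -> u 0 = 0 ->
  measurable_fun (`]0, a[ : set R) u ->
  measurable_fun [set: mR] (u \_ `]- a, a[).
Proof.
move=> us u0 mu; rewrite (symmetric_restrict _ us u0).
have mu1 : measurable_fun [set: mR] (u \_ `]0, a[).
  exact/(measurable_restrictT _ _).1.
apply: measurable_funD => //; apply: measurable_funM => //.
exact: (measurableT_comp mu1 mopp).
Qed.

Let Rintegral_co_oo (s : R) u a :
  (forall t, u (- t) = s * u t) -> u 0 = 0 ->
  measurable_fun (`]0, a[ : set R) u ->
  \int[leb]_(t in `[- a, a[) u t = \int[leb]_t (u \_ `]- a, a[) t.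
Proof.
move=> us u0 mu; rewrite -Rintegral_mkcond /Rintegral integral_itv_obnd_cbnd//.
apply/measurable_EFinP/(measurable_restrictT _ _).2 => //.
exact: measurable_symmetric us u0 mu.
Qed.

(** The reflection exchanges the positive and the negative part, so these have
    equal integrals; if both are infinite, their difference has finite part 0
    by convention. *)
Lemma Rintegral_odd u a : (forall t, u (- t) = - u t) ->
  measurable_fun (`]0, a[ : set R) u ->
  \int[leb]_(t in `[- a, a[) u t = 0.
Proof.
move=> uN mu.
have us t : u (- t) = -1 * u t by rewrite uN mulN1r.
have u0 : u 0 = 0.
  by have /eqP := uN 0; rewrite oppr0 -addr_eq0 -mulr2n mulrn_eq0/= => /eqP.
rewrite (Rintegral_co_oo us u0 mu).
set w := u \_ `]- a, a[.
have mw : measurable_fun [set: mR] (EFin \o w).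
  by apply/measurable_EFinP; exact: measurable_symmetric us u0 mu.
have wN t : w (- t) = - w t.
  rewrite /w !patchE !mem_setE !in_itv/= ltrN2 ltrNl andbC.
  by case: ifPn => _; rewrite ?uN ?oppr0.
rewrite /Rintegral integralE.
rewrite (_ : integral _ _ (fun x => _)^\- = \int[leb]_t ((EFin \o w)^\+ t))%E.
  by case: integral => [r||]//=; rewrite subrr.
rewrite -(integralN (measurable_funepos mw)); apply: eq_integral => t _.
by rewrite funenegE funeposE /= wN.
Qed.

Lemma Rintegral_even u a : (forall t, u (- t) = u t) -> u 0 = 0 ->
  leb.-integrable (`]0, a[ : set R) (EFin \o u) ->
  \int[leb]_(t in `[- a, a[) u t = 2 * \int[leb]_(t in `]0, a[) u t.
Proof.
move=> uN u0 iu.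
have us t : u (- t) = 1 * u t by rewrite uN mul1r.
have mu : measurable_fun (`]0, a[ : set R) u.
  by apply/measurable_EFinP; exact: measurable_int iu.
rewrite (Rintegral_co_oo us u0 mu) (symmetric_restrict _ us u0).
have i1 : leb.-integrable [set: mR] (EFin \o (u \_ `]0, a[)).
  by rewrite -restrict_EFin; apply/(integrable_mkcond _ _).1 => //.
have m1 := measurable_int _ i1.
have i2 : leb.-integrable [set: mR] (EFin \o (fun t => (u \_ `]0, a[) (- t))).
  apply/integrableP; split; first exact: (measurableT_comp m1 mopp).
  have mabs : measurable_fun [set: mR] (abse \o (EFin \o (u \_ `]0, a[))).
    exact: measurableT_comp.
  by have /integrableP[_ u1oo] := i1; have := integralN mabs => /= ->.
under eq_Rintegral do rewrite mul1r.
rewrite RintegralD// mulr_natl mulr2n [in RHS]Rintegral_mkcond; congr (_ + _).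
by rewrite /Rintegral (integralN m1).
Qed.

End parity.

(** * The data coefficients are real *)

Section data_coef_real.
Variable R : realType.
Local Notation leb := (@lebesgue_measure R).
Implicit Types (h : R -> R) (n : nat) (t : R).

Lemma expiD (s t : R) : expi s * expi t = expi (s + t).
Proof.
rewrite /expi cosD sinD; simpc; congr (_ +i* _); ring.
Qed.

Definition data_integrand h n t : R :=
  Num.sg t * h (sin (t / 2) ^+ 2) / (2 * pi).

(** The prefactor [1 / i] exchanges the roles of sine and cosine: the sine, which
    becomes even after multiplication by the sign, gives the real part. *)
Lemma eta_expi h n t : eta h t * expi (n%:R * t) =
  (data_integrand h n t * sin ((n%:R + 2^-1) * t)) +i*
  (- (data_integrand h n t * cos ((n%:R + 2^-1) * t))).
Proof.
have p0 : 2 * pi != 0 :> R by rewrite mulf_neq0// gt_eqF// pi_gt0.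
have inv_i : ((2 * pi)%:C * 'i)^-1 = 0 -i* (2 * pi)^-1 :> R[i].
  apply: (@mulfI _ ((2 * pi)%:C * 'i)).
    by rewrite mulf_neq0 ?neq0Ci// eq_complex/= negb_and p0.
  rewrite divff; last by rewrite mulf_neq0 ?neq0Ci// eq_complex/= negb_and p0.
  by simpc; rewrite mulfV.
rewrite /eta inv_i -!mulrA [(h _)%:C * _]mulrC [expi _ * (_ * _)]mulrA expiD.
rewrite (_ : t / 2 + n%:R * t = (n%:R + 2^-1) * t); last by field.
rewrite /expi /data_integrand; set q := (2 * pi)^-1.
by simpc; congr (_ +i* _); ring.
Qed.

Lemma data_integrandN h n t : data_integrand h n (- t) = - data_integrand h n t.
Proof. by rewrite /data_integrand sgrN (mulNr t) sinN sqrrN !mulNr. Qed.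

Lemma data_integrand_pos h n t : t \in `]0, pi[ ->
  data_integrand h n t = h (sin (t / 2) ^+ 2) / (2 * pi).
Proof. by rewrite in_itv/= => /andP[t0 _]; rewrite /data_integrand gtr0_sg// mul1r. Qed.

Lemma measurable_sin_half n : measurable_fun [set: measurableTypeR R]
  (fun t : R => sin ((n%:R + 2^-1) * t)).
Proof.
apply: continuous_measurable_fun => t.
apply: (@continuous_comp _ _ _ (fun t : R => (n%:R + 2^-1) * t) sin); last exact: continuous_sin.
by apply: cvgM; [exact: cvg_cst|exact: cvg_id].
Qed.

Lemma measurable_cos_half n : measurable_fun [set: measurableTypeR R]
  (fun t : R => cos ((n%:R + 2^-1) * t)).
Proof.
apply: continuous_measurable_fun => t.
apply: (@continuous_comp _ _ _ (fun t : R => (n%:R + 2^-1) * t) cos); last exact: continuous_cos.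
by apply: cvgM; [exact: cvg_cst|exact: cvg_id].
Qed.

Lemma measurable_sin2 h : measurable_fun (`]0, 1[ : set R) h ->
  measurable_fun (`]0, pi[ : set R) (fun t => h (sin (t / 2) ^+ 2)).
Proof.
move=> mh; have := measurable_comp_sin2_half ltr01 mh.
apply: eq_measurable_fun => t _ /=.
by rewrite /sin2_half subr0 mul1r add0r.
Qed.

Lemma measurable_data_integrand h n : measurable_fun (`]0, 1[ : set R) h ->
  measurable_fun (`]0, pi[ : set R) (data_integrand h n).
Proof.
move=> mh; apply: (@eq_measurable_fun _ _ _ _ _
  (fun t => h (sin (t / 2) ^+ 2) * (2 * pi)^-1)).
  by move=> t; rewrite inE/= => tpi; rewrite data_integrand_pos.
by apply: measurable_funM => //; exact: measurable_sin2.
Qed.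

Lemma data_coef_real h n : measurable_fun (`]0, 1[ : set R) h ->
  leb.-integrable (`]0, pi[ : set R)
    (EFin \o (fun t => h (sin (t / 2) ^+ 2) * sin ((n%:R + 2^-1) * t))) ->
  data_coef h n = ((-1) ^+ n * Num.sqrt (2 * n%:R + 1) / pi *
    \int[leb]_(t in `]0, pi[) (h (sin (t / 2) ^+ 2) * sin ((n%:R + 2^-1) * t)))%:C.
Proof.
move=> mh ih; rewrite /data_coef /complex_integral.
under eq_Rintegral do rewrite eta_expi /=.
under [X in _ +i* X]eq_Rintegral do rewrite eta_expi /=.
rewrite [X in _ +i* X]Rintegral_odd; last 2 first.
- by move=> t; rewrite data_integrandN mulrN cosN mulNr.
- apply: measurable_funN; apply: measurable_funM.
    exact: measurable_data_integrand.
  by apply: measurable_funTS; exact: measurable_cos_half.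
have eqpos : {in (`]0, pi[%classic : set R), (fun t => (2 * pi)^-1 *
    (h (sin (t / 2) ^+ 2) * sin ((n%:R + 2^-1) * t))) =1
   (fun t => data_integrand h n t * sin ((n%:R + 2^-1) * t))}.
  move=> t; rewrite inE/= => tpi; rewrite data_integrand_pos//.
  by rewrite mulrCA mulrA.
rewrite Rintegral_even; last 3 first.
- by move=> t; rewrite data_integrandN mulrN sinN mulrNN.
- by rewrite mulr0 sin0 mulr0.
- have mI : measurable (`]0, pi[ : set (measurableTypeR R)) by exact: measurable_itv.
  have := integrableZl mI (2 * pi)^-1 ih.
  by apply: eq_integrable => // t tpi; rewrite /= -EFinM eqpos.
set I := \int[leb]_(t in _) (h _ * _).
have -> : \int[leb]_(t in `]0, pi[) (data_integrand h n t * sin ((n%:R + 2^-1) * t)) =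
    (2 * pi)^-1 * I.
  by rewrite -RintegralZl//; apply: eq_Rintegral => t tpi; rewrite eqpos.
have p0 : (pi : R) != 0 by rewrite gt_eqF// pi_gt0.
have -> : 2 * ((2 * pi)^-1 * I) = pi^-1 * I.
  by rewrite mulrA invfM mulrA mulfV ?mul1r// pnatr_eq0.
have -> : ((-1) ^+ n : R[i]) = ((-1) ^+ n)%:C.
  by rewrite rmorphXn rmorphN1.
by simpc; congr (_ +i* _); rewrite -?mulrA//.
Qed.

End data_coef_real.

(** * Quadratic norms *)

Section l2.
Variable R : realType.
Local Notation leb := (@lebesgue_measure R).
Implicit Types (u : R -> R) (b c : R).

Lemma L2norm01_le (m : {measure set (measurableTypeR R) -> \bar R}) u c : 0 <= c ->
  (L2norm01 m u <= c%:E)%E =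
  (\int[m]_x (((fun x => u x ^+ 2) \_ `]0%R, 1%R[) x)%:E <= (c ^+ 2)%:E)%E.
Proof.
move=> c0; rewrite /L2norm01 unlock poweR12_sqrt; last first.
  by apply: integral_ge0 => x _; exact: poweR_ge0.
have -> : (\int[m]_x `|(EFin \o (u \_ `]0%R, 1%R[)) x| `^ 2 =
    \int[m]_x (((fun x => u x ^+ 2) \_ `]0%R, 1%R[) x)%:E)%E.
  apply: eq_integral => x _; rewrite /= !patchE; case: ifPn => _.
    by rewrite powR_mulrn// real_normK// num_real.
  by rewrite normr0 powR0.
have : (0 <= \int[m]_x (((fun x => u x ^+ 2) \_ `]0%R, 1%R[) x)%:E)%E.
  by apply: integral_ge0 => x _; rewrite lee_fin patchE; case: ifPn => // _; exact: sqr_ge0.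
case: integral => [r||]//= r0; rewrite !lee_fin.
by rewrite -[c in LHS](ger0_norm c0) -sqrtr_sqr ler_sqrt// sqr_ge0.
Qed.

(** Cauchy-Schwarz against the constant 1, from the pointwise inequality
    [`|u| <= (u^2 / s + s) / 2] with the optimal [s]. *)
Lemma integral_abs_le_L2 b c u : 0 < b -> 0 < c ->
  measurable_fun (`]0, b[ : set R) u ->
  (\int[leb]_(x in `]0%R, b[) (u x ^+ 2)%:E <= (c ^+ 2)%:E)%E ->
  (\int[leb]_(x in `]0%R, b[) `|u x|%:E <= (c * Num.sqrt b)%:E)%E.
Proof.
move=> b0 c0 mu u2.
have sb0 : 0 < Num.sqrt b by rewrite sqrtr_gt0.
have sb2 : Num.sqrt b ^+ 2 = b by rewrite sqr_sqrtr// ltW.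
(* The value of [s] at which the bound [(c^2 / s + s b) / 2] is minimal. *)
pose s := c / Num.sqrt b; have s0 : 0 < s by rewrite divr_gt0.
have mu2 : measurable_fun (`]0, b[ : set R) (fun x => u x ^+ 2) by exact: measurable_funX.
apply: (@le_trans _ _
  (\int[leb]_(x in `]0%R, b[) ((2 * s)^-1%:E * (u x ^+ 2)%:E + (s / 2)%:E))%E).
  apply: ge0_le_integral => //.
  - by apply/measurable_EFinP; exact: measurableT_comp.
  - apply: emeasurable_funD => //; apply: emeasurable_funM => //.
    exact/measurable_EFinP.
  - move=> x _; rewrite -EFinM -EFinD lee_fin -real_normK ?num_real//.
    set a := `|u x|.
    have : 0 <= (a - s) ^+ 2 / (2 * s) by rewrite divr_ge0 ?sqr_ge0// mulr_ge0// ltW.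
    rewrite (_ : (a - s) ^+ 2 / (2 * s) = (2 * s)^-1 * a ^+ 2 + s / 2 - a).
      by rewrite subr_ge0.
    by field; rewrite gt_eqF.
rewrite ge0_integralD//; last 3 first.
- by move=> x _; rewrite -EFinM lee_fin mulr_ge0 ?sqr_ge0// invr_ge0 mulr_ge0// ltW.
- by apply: emeasurable_funM => //; exact/measurable_EFinP.
- by move=> x _; rewrite lee_fin divr_ge0// ltW.
rewrite ge0_integralZl//; last 3 first.
- exact/measurable_EFinP.
- by move=> x _; rewrite lee_fin sqr_ge0.
- by rewrite lee_fin invr_ge0 mulr_ge0// ltW.
rewrite integral_cst//= lebesgue_measure_itv/= lte_fin b0 -EFinD subr0.
apply: (@le_trans _ _ ((2 * s)^-1%:E * (c ^+ 2)%:E + (s / 2)%:E * b%:E)%E).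
  apply: leeD => //; apply: lee_wpmul2l => //.
  by rewrite lee_fin invr_ge0 mulr_ge0// ltW.
rewrite -!EFinM -EFinD lee_fin le_eqVlt; apply/orP; left; apply/eqP.
rewrite -[X in s / 2 * X]sb2 /s; field.
by rewrite !gt_eqF.
Qed.

End l2.

(** * Comparison of the coefficients and conclusion *)

Section final.
Variable R : realType.
Local Notation leb := (@lebesgue_measure R).
Local Notation mR := (measurableTypeR R).

Lemma L2on01_integrable (f : R -> R) : L2on01 leb f ->
  leb.-integrable (`]0, 1[ : set R) (EFin \o f).
Proof.
move=> [mf f2]; apply/integrableP; split; first exact/measurable_EFinP.
have [c c0 fc] : exists2 c : R, 0 < c & (L2norm01 leb f <= c%:E)%E.
  have N0 : (0 <= L2norm01 leb f)%E by exact: Lnorm_ge0.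
  exists (fine (L2norm01 leb f) + 1); first by rewrite ltr_wpDl// fine_ge0.
  by rewrite EFinD fineK ?ge0_fin_numE// leeDl// lee_fin.
move: fc; rewrite (L2norm01_le _ _ (ltW c0)) => fc.
apply: (@le_lt_trans _ _ (c * Num.sqrt 1)%:E); last exact: ltry.
apply: integral_abs_le_L2 => //; apply: le_trans fc.
rewrite integral_mkcond le_eqVlt; apply/orP; left; apply/eqP.
by apply: eq_integral => x _; rewrite !patchE; case: ifPn.
Qed.

Let theta n (t : R) := (n%:R + 2^-1) * t.

Section coefficients.
Variables (f : R -> R) (n : nat).
Hypothesis hf : L2on01 leb f.
Let mf : measurable_fun (`]0, 1[ : set R) f. Proof. exact: hf.1. Qed.
Let fi := L2on01_integrable hf.

(** The integrand [abel f x * sin((n + 1/2) t)] in the variable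
    [x = sin^2(t/2)], up to sign; the factor [sqrt x] compensates the singularity
    at 0 of the arcsine weight. *)
Let G (x : R) := abel f x * (Num.sqrt x * airfoil n (1 - x)).

Let mG : measurable_fun (`]0, 1[ : set R) G.
Proof.
apply: measurable_funM; first exact: measurable_abel.
apply: measurable_funTS; apply: measurable_funM.
  exact: continuous_measurable_fun (@sqrt_continuous R).
apply: continuous_measurable_fun => x.
apply: (@continuous_comp _ _ _ (fun x : R => 1 - x) (airfoil n)); last exact: continuous_airfoil.
by apply: cvgB; [exact: cvg_cst|exact: cvg_id].
Qed.

Let G_weight : {in (`]0, 1[%classic : set R),
  (fun x => abel f x * (airfoil n (1 - x) * inv_sqrt (1 - x))) =1
  (fun x => G x / Num.sqrt ((x - 0) * (1 - x)))}.
Proof.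
move=> x; rewrite inE/= in_itv/= => /andP[x0 x1].
rewrite subr0 -/(inv_sqrt _) inv_sqrtM ?ltW// /G /inv_sqrt; field.
by rewrite !gt_eqF// sqrtr_gt0 ?subr_gt0.
Qed.

Let G_sin : {in (`]0, pi[%classic : set R), (fun t => (-1) ^+ n * G (sin2_half 0 1 t)) =1
  (fun t => abel f (sin (t / 2) ^+ 2) * sin (theta n t))}.
Proof.
move=> t; rewrite inE/= => tpi; have [s0 c0] := half_pi_itv tpi.
rewrite /G /theta sin_half_airfoil (_ : sin2_half 0 1 t = sin (t / 2) ^+ 2).
  by rewrite sqrtr_sqr (gtr0_norm s0) -cos2sin2; ring.
by rewrite /sin2_half subr0 mul1r add0r.
Qed.

Let iGphi : leb.-integrable (`]0, pi[ : set R) (EFin \o (G \o sin2_half 0 1)).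
Proof.
apply: integrable_arcsine_substitution => //.
apply: eq_integrable (integrable_abel_airfoil n mf fi) => //.
by move=> x x01 /=; rewrite G_weight.
Qed.

Lemma integrable_abel_sin : leb.-integrable (`]0, pi[ : set R)
  (EFin \o (fun t => abel f (sin (t / 2) ^+ 2) * sin (theta n t))).
Proof.
have mI : measurable (`]0, pi[ : set mR) by exact: measurable_itv.
have := integrableZl mI ((-1) ^+ n) iGphi.
by apply: eq_integrable => // t tpi; rewrite /= -EFinM G_sin.
Qed.

(** The identity behind the inversion method: exact data give back the exact
    Legendre coefficients. *)
Lemma legendre_coef_abel : legendre_coef f n =
  (-1) ^+ n * Num.sqrt (2 * n%:R + 1) / pi *
  \int[leb]_(t in `]0, pi[) (abel f (sin (t / 2) ^+ 2) * sin (theta n t)).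
Proof.
have -> : legendre_coef f n = Num.sqrt (2 * n%:R + 1) *
    \int[leb]_(x in `]0, 1[) (f x * (legendre R n).[2 * x - 1]).
  rewrite -RintegralZl//; last exact: integrable_mul_legendre.
  by apply: eq_Rintegral => x _; rewrite /shifted_legendre mulrCA.
have <- : \int[leb]_(t in `]0, pi[) ((-1) ^+ n * G (sin2_half 0 1 t)) =
    \int[leb]_(t in `]0, pi[) (abel f (sin (t / 2) ^+ 2) * sin (theta n t)).
  by apply: eq_Rintegral => t tpi; rewrite G_sin.
rewrite RintegralZl// {2}/Rintegral -arcsine_substitution//.
have -> : (\int[leb]_(x in `]0%R, 1%R[) (G x / Num.sqrt ((x - 0) * (1 - x)))%:E =
    \int[leb]_(x in `]0%R, 1%R[) (abel f x * (airfoil n (1 - x) * inv_sqrt (1 - x)))%:E)%E.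
  by apply: eq_integral => x x01; rewrite -G_weight.
rewrite -/(Rintegral _ _ _) integral_abel_airfoil//.
set I := Rintegral _ _ _.
have s1 : (-1) ^+ n * (-1) ^+ n = 1 :> R by rewrite -exprMn mulrNN mulr1 expr1n.
have p0 : (pi : R) != 0 by rewrite gt_eqF// pi_gt0.
transitivity (((-1) ^+ n * (-1) ^+ n) * (pi^-1 * pi) * Num.sqrt (2 * n%:R + 1) * I).
  by rewrite s1 mulVf// !mul1r.
by rewrite !mulrA; congr (_ * _); ring.
Qed.

End coefficients.

Section noise.
Variables (h : R -> R) (eps : R).
Hypotheses (eps0 : 0 < eps) (mh : measurable_fun (`]0, 1[ : set R) h).
Hypothesis heps : (L2norm01 (@arcsine_measure R) h <= eps%:E)%E.

Let hs (t : R) := h (sin (t / 2) ^+ 2).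

Let mhs : measurable_fun (`]0, pi[ : set R) hs. Proof. exact: measurable_sin2. Qed.

Let hs1 : (\int[leb]_(t in `]0%R, pi[) `|hs t|%:E <= (eps * Num.sqrt pi)%:E)%E.
Proof.
apply: integral_abs_le_L2 => //; first exact: pi_gt0.
move: heps; rewrite (L2norm01_le _ _ (ltW eps0)); apply: le_trans.
rewrite (ge0_integral_arcsine_measure (G := fun x => h x ^+ 2))//.
- exact: measurable_funX.
- by move=> x; exact: sqr_ge0.
Qed.

Let mhsin n : measurable_fun (`]0, pi[ : set R) (fun t => hs t * sin (theta n t)).
Proof.
by apply: measurable_funM => //; apply: measurable_funTS; exact: measurable_sin_half.
Qed.

Let hsin_le n : (\int[leb]_(t in `]0%R, pi[) `|hs t * sin (theta n t)|%:E <=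
  (eps * Num.sqrt pi)%:E)%E.
Proof.
apply: le_trans hs1; apply: ge0_le_integral => //.
- by apply/measurable_EFinP; apply: measurableT_comp => //; exact: mhsin.
- by apply/measurable_EFinP; exact: measurableT_comp.
- by move=> t _; rewrite lee_fin normrM ler_piMr// sin_max.
Qed.

Lemma integrable_noise_sin n : leb.-integrable (`]0, pi[ : set R)
  (EFin \o (fun t => h (sin (t / 2) ^+ 2) * sin (theta n t))).
Proof.
apply/integrableP; split.
  by apply/measurable_EFinP; exact: mhsin.
by apply: le_lt_trans (hsin_le n) _; exact: ltry.
Qed.

(** The sine is bounded by 1, and [sqrt pi] comes from comparing the [L^1] and
    [L^2] norms on an interval of length [pi]. *)
Lemma noise_sin_le n :
  `|\int[leb]_(t in `]0, pi[) (h (sin (t / 2) ^+ 2) * sin (theta n t))|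
    <= eps * Num.sqrt pi.
Proof.
have mI : measurable (`]0, pi[ : set mR) by exact: measurable_itv.
rewrite -lee_fin EFin_normr_Rintegral//; last exact: integrable_noise_sin.
apply: le_trans (hsin_le n); apply: le_abse_integral => //.
by apply/measurable_EFinP; exact: mhsin.
Qed.

End noise.

End final.

Theorem proposition2 (R : realType) (f : R -> R)
    (hf : L2on01 lebesgue_measure f)
    (eps : R) (eps_gt0 : 0 < eps)
    (geps : R -> R) (mgeps : measurable_fun (`]0, 1[ : set R) geps)
    (hgeps : (L2norm01 (@arcsine_measure R) (abel f \- geps)%R <= eps%:E)%E)
    (N : nat) :
  let fN := legendre_sum (fun n => (legendre_coef f n)%:C) N in
  let fNeps := legendre_sum (data_coef geps) N in
  (complex_L2norm01 lebesgue_measure (fN \- fNeps)%R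
     <= (N.+1%:R / Num.sqrt pi * eps)%:E)%E.
Proof.
cbv zeta; set fN := legendre_sum (fun n => _) N.
set fNeps := legendre_sum (data_coef geps) N.
(* The noise; its coefficients are the errors [d n]. *)
pose h := (abel f \- geps)%R.
have mh : measurable_fun (`]0, 1[ : set R) h.
  by apply: measurable_funB => //; exact: measurable_abel hf.1.
pose S (u : R -> R) n := \int[lebesgue_measure]_(t in `]0, pi[)
  (u (sin (t / 2) ^+ 2) * sin ((n%:R + 2^-1) * t)).
pose k n : R := (-1) ^+ n * Num.sqrt (2 * n%:R + 1) / pi.
pose d n : R := k n * S h n.
have ih n := integrable_noise_sin eps_gt0 mh hgeps n.
have ig n := integrable_abel_sin n hf.
have igeps n : lebesgue_measure.-integrable (`]0, pi[ : set R)
    (EFin \o (fun t => geps (sin (t / 2) ^+ 2) * sin ((n%:R + 2^-1) * t))).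
  have mI : measurable (`]0, pi[ : set (measurableTypeR R)) by exact: measurable_itv.
  have := integrableB mI (ig n) (ih n).
  by apply: eq_integrable => // t _; rewrite /= -EFinB /h/=; congr EFin; ring.
(* The exact coefficients are those of the exact data, and the data coefficient is
   linear in the data. *)
have dE n : (legendre_coef f n)%:C - data_coef geps n = (d n)%:C.
  rewrite data_coef_real// legendre_coef_abel// -rmorphB/= -mulrBr /d; congr ((_ * _)%:C).
  rewrite -RintegralB//; apply: eq_Rintegral => t _; rewrite /h/=; ring.
have fNE x : ComplexField.Normc.normc ((fN \- fNeps) x) =
    `|\sum_(n < N.+1) d n * shifted_legendre n x|.
  have -> : (fN \- fNeps) x = (\sum_(n < N.+1) d n * shifted_legendre n x)%:C.
    rewrite -[LHS]/(fN x - fNeps x) rmorph_sum -sumrB; apply: eq_bigr => n _.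
    transitivity (((legendre_coef f n)%:C - data_coef geps n) * (shifted_legendre n x)%:C).
      by rewrite mulrBl.
    by rewrite dE; exact: esym (rmorphM _ _ _).
  by rewrite /= expr0n addr0 sqrtr_sqr.
have p0 : 0 < Num.sqrt pi :> R by rewrite sqrtr_gt0 pi_gt0.
have p2 : Num.sqrt pi ^+ 2 = pi :> R by rewrite sqr_sqrtr// pi_ge0.
rewrite /complex_L2norm01 L2norm01_le; last by rewrite mulr_ge0 ?ltW// divr_gt0.
rewrite (_ : integral _ _ _ = (\sum_(n < N.+1) d n ^+ 2)%:E); last first.
  rewrite -legendre_parseval [RHS]integral_mkcond; apply: eq_integral => x _.
  by rewrite restrict_EFin /= !patchE; case: ifPn => // _; rewrite fNE real_normK// num_real.
rewrite lee_fin.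
have dle n : d n ^+ 2 <= (2 * n%:R + 1) * (eps ^+ 2 / pi).
  have n0 : 0 <= 2 * n%:R + 1 :> R by rewrite addr_ge0// mulr_ge0.
  have S2 : S h n ^+ 2 <= eps ^+ 2 * pi.
    rewrite -real_normK ?num_real// -p2 -exprMn.
    apply: lerXn2r; last exact: noise_sin_le.
      by rewrite nnegrE.
    by rewrite nnegrE mulr_ge0// ltW.
  rewrite /d exprMn /k !exprMn sqr_sqrtr// -exprM mulnC exprM sqrrN !expr1n mul1r.
  rewrite -mulrA ler_wpM2l// exprVn.
  apply: le_trans (ler_wpM2l _ S2) _; first by rewrite invr_ge0 sqr_ge0.
  rewrite le_eqVlt; apply/orP; left; apply/eqP.
  by move: (pi : R) (pi_gt0 R) => q q0; field; rewrite gt_eqF.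
apply: le_trans (ler_sum _ (fun (n : 'I_N.+1) _ => dle n)) _.
rewrite -mulr_suml.
have -> : \sum_(n < N.+1) (2 * n%:R + 1) = N.+1%:R ^+ 2 :> R.
  elim: N {fN fNeps fNE} => [|N IH]; first by rewrite big_ord1 expr1n mulr0 add0r.
  by rewrite big_ord_recr/= IH -[N.+2]addn1 natrD; ring.
by rewrite !exprMn exprVn p2 mulrA mulrAC.
Qed.
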